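(* Let $A$ be a non-critical minimax abelian group, and write $h=h(A)$, $n=n(A)$. Then the space $\mathcal{S}(A)$ is countable, and homeomorphic to $D^{h}\times [n]$.
   Context: For an abelian group $A$, $\mathcal{S}(A)$ denotes the set of all subgroups of $A$, with the topology induced by the product topology on $2^A$. An abelian group is Artinian if every non-increasing sequence of subgroups stabilizes. An abelian group $A$ is minimax if it has a finitely generated subgroup $Z$ with $A/Z$ Artinian. For a prime $p$, $C_{p^\infty}=\mathbf{Z}[1/p]/\mathbf{Z}$. Let $A$ be minimax. For a prime $p$, $\ell_p(A)$ is the largest integer $k$ such that $A$ maps onto $C_{p^\infty}^k$; $r(A)=\dim_{\mathbf{Q}}(A\otimes_{\mathbf{Z}}\mathbf{Q})$ is the rank of $A$; the height $h(A)=r(A)+\sum_{p\text{ prime}}\ell_p(A)$ is finite. A prime $p$ is critical for $A$ if $\ell_p(A)\ge 2$; $A$ is critical if it has at least one critical prime, and non-critical otherwise. $T_A$ is the torsion subgroup of $A$, and $\mathrm{Div}(A)$ is the subgroup of divisible elements (elements lying in $kA$ for all non-zero integers $k$); for $A$ minimax, $\mathrm{Div}(A)$ is contained in $T_A$ with finite index, and $n(A)$ denotes the number of subgroups of the finite group $T_A/\mathrm{Div}(A)$. $[n]=\{0,\dots,n-1\}$ is a discrete space with $n$ points. $D=\omega\cup\{\infty\}$ is the one-point compactification of the countable discrete space $\omega$ (equivalently $\{1/k : k\ge 1\}\cup\{0\}\subset\mathbf{R}$); $D^0$ is a singleton. *)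

(* Defs.v *)
From HB Require Import structures.
From mathcomp Require Import all_boot all_order all_algebra finmap.
From mathcomp Require Import all_classical.
From mathcomp Require Import topology.

Set Implicit Arguments.
Unset Strict Implicit.
Unset Printing Implicit Defensive.

Import GRing.Theory.

Local Open Scope classical_set_scope.
Local Open Scope ring_scope.

Definition homeomorphic (X Y : topologicalType) : Prop :=
  exists (f : X -> Y) (g : Y -> X),
    [/\ cancel f g, cancel g f, continuous f & continuous g].

(* The power set 2^A is the product of copies of the discrete space bool. *)
Definition subgroup_set (A : zmodType) : set (prod_topology (fun _ : A => bool)) :=
  [set H | zmod_closed (H : {pred A})].

(* [set_type] carries the subspace topology. *)
Definition subgroups (A : zmodType) : Type := set_type (@subgroup_set A).

HB.instance Definition _ (A : zmodType) :=
  Topological.copy (subgroups A) (set_type (@subgroup_set A)).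

Section Subgroups.
Variable A : zmodType.

Definition subgroup_mem (H : subgroups A) : {pred A} := set_val H.

Coercion subgroup_mem : subgroups >-> pred_sort.

Fact subgroup_mem_closed (H : subgroups A) : zmod_closed (subgroup_mem H).
Proof. exact: set_mem (valP H). Qed.

HB.instance Definition _ (H : subgroups A) :=
  GRing.isZmodClosed.Build A (subgroup_mem H) (subgroup_mem_closed H).

Definition Subgroup (P : set A) (P_closed : zmod_closed (fun x => `[< P x >])) :
    subgroups A :=
  exist _ (fun x => `[< P x >]) (mem_set P_closed).

Definition subgroup_type (H : subgroups A) : Type := {x : A | x \in subgroup_mem H}.

HB.instance Definition _ (H : subgroups A) := SubChoice.on (subgroup_type H).
HB.instance Definition _ (H : subgroups A) :=
  [SubChoice_isSubZmodule of subgroup_type H by <:].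

End Subgroups.

Fact subgroup_in_closed (A : zmodType) (H K : subgroups A) :
  zmod_closed (fun x : subgroup_type K => `[< val x \in subgroup_mem H >]).
Proof.
split; first by apply/asboolP; rewrite raddf0 rpred0.
move=> x y /asboolP Hx /asboolP Hy; apply/asboolP.
by rewrite raddfB rpredB.
Qed.

(* H `&` K viewed as a subgroup of the group K. *)
Definition subgroup_in (A : zmodType) (H K : subgroups A) :
    subgroups (subgroup_type K) :=
  Subgroup (@subgroup_in_closed A H K).

(* The group K / (H `&` K), i.e. K / H when H is contained in K. *)
Definition subquotient (A : zmodType) (K H : subgroups A) : zmodType :=
  Quotient.quot (subgroup_mem (subgroup_in H K)).

Definition finitely_generated (A : zmodType) (Z : subgroups A) : Prop :=
  exists s : seq A, forall x : A,
    x \in Z <-> (forall H : subgroups A, {subset s <= H} -> x \in H).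

Definition artinian (A : zmodType) : Prop :=
  forall u : nat -> subgroups A, (forall i, {subset u i.+1 <= u i}) ->
    exists N : nat, forall i, (N <= i)%N -> u i = u N.

Definition minimax (A : zmodType) : Prop :=
  exists Z : subgroups A,
    finitely_generated Z /\ artinian (Quotient.quot (subgroup_mem Z)).

Fact Zinv_closed (p : nat) :
  zmod_closed (fun q : rat =>
    `[< exists (m : int) (k : nat), q = m%:~R / p%:R ^+ k >]).
Proof.
split; first by apply/asboolP; exists 0, 0%N; rewrite mul0r.
move=> _ _ /asboolP[m [k ->]] /asboolP[n [l ->]]; apply/asboolP.
have [->|p0] := eqVneq (p%:R : rat) 0.
  case: k l => [|k] [|l]; rewrite ?expr0 ?exprS ?mul0r ?invr0 ?mulr0 ?subr0 ?divr1.
  - by exists (m - n), 0%N; rewrite expr0 divr1 rmorphB.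
  - by exists m, 0%N; rewrite expr0 divr1.
  - by exists (- n), 0%N; rewrite expr0 divr1 rmorphN sub0r.
  - by exists 0, 0%N; rewrite mul0r.
exists (m * p%:Z ^+ l - n * p%:Z ^+ k), (k + l)%N.
rewrite rmorphB !rmorphM !rmorphXn /= -!pmulrn exprD mulrBl.
by rewrite invfM !mulrA mulfK ?expf_neq0// [_ / _ / _]mulrAC mulfK ?expf_neq0.
Qed.

(* Z[1/p] as a subgroup of the rationals. *)
Definition Zinv (p : nat) : subgroups rat := Subgroup (Zinv_closed p).

Fact Zrat_closed : zmod_closed (fun q : rat => `[< exists m : int, q = m%:~R >]).
Proof.
split; first by apply/asboolP; exists 0.
move=> _ _ /asboolP[m ->] /asboolP[n ->]; apply/asboolP.
by exists (m - n); rewrite rmorphB.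
Qed.

Definition Zrat : subgroups rat := Subgroup Zrat_closed.

Definition prufer (p : nat) : zmodType := subquotient (Zinv p) Zrat.

Definition maps_onto (A B : zmodType) : Prop :=
  exists f : {additive A -> B}, forall y, exists x, f x = y.

(* The junk value 0 is returned when there is no largest such k. *)
Definition ell (p : nat) (A : zmodType) : nat :=
  xget 0%N [set k | maps_onto A {ffun 'I_k -> prufer p} /\
    forall j, maps_onto A {ffun 'I_j -> prufer p} -> (j <= k)%N].

Definition biadditive (A B C : zmodType) (t : A -> B -> C) : Prop :=
  (forall a a' b, t (a - a') b = t a b - t a' b) /\
  (forall a b b', t a (b - b') = t a b - t a b').

(* V, with the pure tensors t, is the tensor product of A and rat over the
   integers, with rat acting through the right-hand factor. *)
Definition is_tensor_rat (A : zmodType) (V : lmodType rat) (t : A -> rat -> V) :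
    Prop :=
  [/\ biadditive t,
      forall a c q, t a (c * q) = c *: t a q &
      forall (W : zmodType) (b : A -> rat -> W), biadditive b ->
        exists2 g : {additive V -> W}, (forall a q, g (t a q) = b a q) &
          forall g' : {additive V -> W},
            (forall a q, g' (t a q) = b a q) -> g' =1 g].

(* The junk value 0 is returned when A (x) Q has infinite dimension. *)
Definition rank (A : zmodType) : nat :=
  xget 0%N [set r | exists (V : vectType rat) (t : A -> rat -> V),
    is_tensor_rat t /\ (\dim {:V})%VS = r].

(* A sum with infinitely many nonzero terms has value 0 by convention. *)
Definition height (A : zmodType) : nat :=
  (rank A + \big[addn/0%N]_(p \in [set p : nat | prime p]) ell p A)%N.

Definition critical_prime (A : zmodType) (p : nat) : Prop :=
  prime p /\ (2 <= ell p A)%N.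

Definition critical (A : zmodType) : Prop := exists p, critical_prime A p.

Fact torsion_closed (A : zmodType) :
  zmod_closed (fun x : A => `[< exists2 m : nat, (0 < m)%N & x *+ m = 0 >]).
Proof.
split; first by apply/asboolP; exists 1%N.
move=> x y /asboolP[m m0 xm] /asboolP[n n0 yn]; apply/asboolP.
exists (m * n)%N; first by rewrite muln_gt0 m0.
by rewrite mulrnBl mulrnA xm mul0rn mulnC mulrnA yn mul0rn subr0.
Qed.

Definition torsion (A : zmodType) : subgroups A := Subgroup (torsion_closed A).

Fact divisible_closed (A : zmodType) :
  zmod_closed (fun x : A => `[< forall k : int, k != 0 -> exists y, x = y *~ k >]).
Proof.
split; first by apply/asboolP => k _; exists 0; rewrite mul0rz.
move=> x y /asboolP xd /asboolP yd; apply/asboolP => k k0.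
have [[x' ->] [y' ->]] := (xd k k0, yd k k0).
by exists (x' - y'); rewrite mulrzBl.
Qed.

Definition Div (A : zmodType) : subgroups A := Subgroup (divisible_closed A).

(* [fset_set] of an infinite set is empty. *)
Definition nb_subgroups (A : zmodType) : nat :=
  #|` fset_set [set: subgroups A]|%fset.

Definition card_subgroups_TDiv (A : zmodType) : nat :=
  nb_subgroups (subquotient (torsion A) (Div A)).

Definition D : topologicalType := one_point_compactification nat.

Definition D_pow (h : nat) : topologicalType := prod_topology (fun _ : 'I_h => D).

Definition discrete_ord (n : nat) : topologicalType := discrete_topology 'I_n.

(* Main.v *)
Require Import Defs.
From HB Require Import structures.
From mathcomp Require Import all_boot all_order all_algebra.
From mathcomp Require finmap.
From mathcomp Require Import all_classical.
From mathcomp Require Import topology.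
From mathcomp Require Import zify.

Set Implicit Arguments.
Unset Strict Implicit.
Unset Printing Implicit Defensive.

Import Order.TTheory GRing.Theory Num.Theory.

Local Open Scope classical_set_scope.
Local Open Scope ring_scope.

(* A countable compact zero-dimensional space X carrying a rank function
   rho : X -> nat (near x every other point has smaller rank, and every
   neighbourhood of a point of positive rank contains a point of rank one less)
   is determined up to homeomorphism by the maximal rank h and the number n of
   points of rank h: by induction on h, a clopen set with a single point x of
   maximal rank is x together with a sequence, converging to x, of clopen sets
   having a single point of maximal rank h - 1.  On D^h x [n] the number of
   infinite coordinates is such a rank.

   On S(A) the rank is h(A) - r(H) - #{p : the p-part of A/H has unbounded
   exponent}.  Let H' <= H be finitely generated with H/H' divisible torsion.  A
   subgroup K close to H contains H' and avoids representatives of the socles of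
   A/H and of A/H' outside H; since A is non-critical, a prime p which is
   unbounded for H is not involved in H/H', and this forces the rank of K to be
   smaller unless K = H.  Conversely, the rank drops by exactly one either by
   replacing H with the kernel of a surjection from H to a Pruefer group, or by
   adding to H a deep multiple of a suitable subgroup of rank one.  The subgroups
   of maximal rank are those between Div(A) and T_A. *)

(** * Spaces with a rank function *)

(** Non-criticality enters twice. Since every ell_p is at most 1, A/H has at most one Pruefer
    p-group to offer, so it suffices to record whether there is one; this is why primes are merely
    counted in the rank. And a Pruefer section at p cannot occur both in A/H and in H, for A would
    then map onto the square of the Pruefer group. Chains in A/Z are replaced by chains of subgroups
    of A containing Z. The consequence used everywhere is that A/K has a finite socle for every
    subgroup K: finitely many test elements, hence a basic open set of S(A), then decide whether a
    torsion element modulo K can appear. Z is enlarged so that A/Z is also divisible, which is what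
    bounds ell_p. The obstacle in moving the rank by exactly one is that adjoining a multiple of x
    to H can make a prime unbounded at the same time: in Z[1/p] the subgroup 0 is bounded at p and Z
    is not. So x must first be divided by all bounded primes, but not by the unbounded ones, where
    the torsion modulo H has no exponent. *)

Definition homeo_on (X Y : topologicalType) (U : set X) (V : set Y) : Prop :=
  exists (f : X -> Y) (g : Y -> X),
  [/\ forall x, U x -> V (f x) /\ g (f x) = x,
      forall y, V y -> U (g y) /\ f (g y) = y,
      forall x, U x -> {for x, continuous f} &
      forall y, V y -> {for y, continuous g}].

Lemma continuous_at_eq_near (X Y : topologicalType) (f g : X -> Y) (x : X) :
  (\forall z \near x, f z = g z) -> {for x, continuous f} ->
  {for x, continuous g}.
Proof.
move=> fg cf; have gx := nbhs_singleton fg.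
rewrite /prop_for /continuous_at -gx; apply: cvg_trans cf; apply: near_eq_cvg.
by near=> z; apply: (near fg).
Unshelve. all: by end_near. Qed.

(** The maps in [homeo_on] are total and continuous in the ambient space at the points of U; with
    open pieces, the glued map agrees near each point with one of the given maps. *)
Lemma homeo_onU (X Y : topologicalType) (U U' : set X) (V V' : set Y) :
  open U -> open U' -> open V -> open V' ->
  U `&` U' = set0 -> V `&` V' = set0 ->
  homeo_on U V -> homeo_on U' V' -> homeo_on (U `|` U') (V `|` V').
Proof.
move=> oU oU' oV oV' dU dV [f [g [fU gV cf cg]]] [f' [g' [fU' gV' cf' cg']]].
have dis (Z : topologicalType) (P Q : set Z) z :
    P `&` Q = set0 -> Q z -> ~ P z.
  by move=> dPQ Qz Pz; have : set0 z by rewrite -dPQ.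
pose glue (Z W : topologicalType) (P : set Z) (a b : Z -> W) :=
  fun z => if z \in P then a z else b z.
have glueL (Z W : topologicalType) (P : set Z) (a b : Z -> W) z :
    P z -> glue _ _ P a b z = a z by move=> Pz; rewrite /glue mem_set.
have glueR (Z W : topologicalType) (P Q : set Z) (a b : Z -> W) z :
    P `&` Q = set0 -> Q z -> glue _ _ P a b z = b z.
  by move=> dPQ Qz; rewrite /glue memNset //; apply: dis dPQ Qz.
have cglue (Z W : topologicalType) (P Q : set Z) (a b : Z -> W) :
    open P -> open Q -> P `&` Q = set0 ->
    (forall z, P z -> {for z, continuous a}) ->
    (forall z, Q z -> {for z, continuous b}) ->
    forall z, (P `|` Q) z -> {for z, continuous (glue _ _ P a b)}.
  move=> oP oQ dPQ ca cb z [Pz|Qz].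
  - apply: continuous_at_eq_near (ca _ Pz).
    by near=> w; rewrite glueL //; near: w; apply: open_nbhs_nbhs.
  - apply: continuous_at_eq_near (cb _ Qz).
    by near=> w; rewrite (glueR _ _ _ Q) //; near: w; apply: open_nbhs_nbhs.
exists (glue _ _ U f f'), (glue _ _ V g g'); split.
- move=> x [Ux|Ux]; last rewrite (glueR _ _ _ U')//.
  + by have [Vf gf] := fU _ Ux; rewrite !glueL//; split => //; left.
  + by have [Vf gf] := fU' _ Ux; rewrite (glueR _ _ _ V')//; split => //; right.
- move=> x [Ux|Ux]; last rewrite (glueR _ _ _ V')//.
  + by have [Vf gf] := gV _ Ux; rewrite !glueL//; split => //; left.
  + by have [Vf gf] := gV' _ Ux; rewrite (glueR _ _ _ U')//; split => //; right.
- exact: cglue.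
- exact: cglue.
Unshelve. all: by end_near. Qed.

Definition converges_to (X : topologicalType) (U : nat -> set X) (x : X) : Prop :=
  forall W, nbhs x W -> exists N, forall i, (N <= i)%N -> U i `<=` W.

(** Only continuity at the base point needs an argument: a neighbourhood of the image contains all
    pieces but finitely many, and these are closed and miss the base point. The assumptions
    [nbhs x0 _] and [nbhs y0 _] are there because continuity is meant in the ambient space. *)
Lemma homeo_on_bouquet (X Y : topologicalType) (x0 : X) (y0 : Y)
    (U : nat -> set X) (V : nat -> set Y) :
  (forall i, clopen (U i)) -> (forall i, clopen (V i)) ->
  trivIset setT U -> trivIset setT V ->
  (forall i, ~ U i x0) -> (forall i, ~ V i y0) ->
  converges_to U x0 -> converges_to V y0 ->
  nbhs x0 (x0 |` \bigcup_i U i) -> nbhs y0 (y0 |` \bigcup_i V i) ->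
  (forall i, homeo_on (U i) (V i)) ->
  homeo_on (x0 |` \bigcup_i U i) (y0 |` \bigcup_i V i).
Proof.
move=> clU clV tU tV nU nV cU cV nbU nbV /choice[f fP].
have /choice[g fg] := fP.
(* Off all the pieces, in particular at the base point, the value is w. *)
pose glue (Z W : topologicalType) (P : nat -> set Z) (w : W) (a : nat -> Z -> W) z :=
  if pselect (exists i, P i z) is left e then a (projT1 (cid e)) z else w.
have glueE (Z W : topologicalType) (P : nat -> set Z) (w : W) a i z :
    trivIset setT P -> P i z -> glue _ _ P w a z = a i z.
  move=> tP Pz; rewrite /glue; case: pselect => [e|[]]; last by exists i.
  by case: cid => j Pj /=; rewrite (tP j i) //; exists z.
have glue0 (Z W : topologicalType) (P : nat -> set Z) (w : W) a z :
    (forall i, ~ P i z) -> glue _ _ P w a z = w.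
  by move=> nP; rewrite /glue; case: pselect => // e; have [i /nP] := e.
have cglue (Z W : topologicalType) (P : nat -> set Z) (Q : nat -> set W) z0 w0 a :
    (forall i, clopen (P i)) -> trivIset setT P -> (forall i, ~ P i z0) ->
    converges_to Q w0 -> nbhs z0 (z0 |` \bigcup_i P i) ->
    (forall i z, P i z -> Q i (a i z)) ->
    (forall i z, P i z -> {for z, continuous (a i)}) ->
    forall z, (z0 |` \bigcup_i P i) z -> {for z, continuous (glue _ _ P w0 a)}.
  move=> clP tP nP cQ nbP aQ ca z [->|[i _ Pz]]; last first.
    apply: continuous_at_eq_near (ca i z Pz); near=> w.
    rewrite (glueE _ _ _ _ _ i) //; near: w; apply: open_nbhs_nbhs.
    by split => //; case: (clP i).
  rewrite /prop_for /continuous_at glue0 // => T /= w0T.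
  have [N cN] := cQ _ w0T.
  have nb : nbhs z0 (\bigcap_(i in `I_N) ~` P i).
    elim: N {cN} => [|N nN]; first by rewrite II0 bigcap_set0; apply: filterT.
    rewrite IIS bigcap_setU bigcap_set1; apply: filterI => //.
    apply: open_nbhs_nbhs; split; last exact: nP.
    by apply: closed_openC; case: (clP N).
  change (nbhs z0 [set w | T (glue _ _ P w0 a w)]); near=> w => /=.
  have : (z0 |` \bigcup_i P i) w by near: w.
  case=> [->|[i _ Pi]]; first by rewrite glue0 //; apply: nbhs_singleton.
  rewrite (glueE _ _ _ _ _ i) //; apply: (cN i); last exact: aQ.
  rewrite leqNgt; apply/negP => iN.
  suff: (\bigcap_(i in `I_N) ~` P i) w by move=> /(_ i iN); apply.
  by near: w.
exists (glue _ _ U y0 f), (glue _ _ V x0 g); split.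
- move=> x [->|[i _ Ui]].
    by rewrite !glue0 //; split => //; left.
  have [/(_ _ Ui)[Vf gf] _ _ _] := fg i.
  by rewrite (glueE _ _ U _ _ i)// (glueE _ _ V _ _ i)//; split => //; right; exists i.
- move=> y [->|[i _ Vi]].
    by rewrite !glue0 //; split => //; left.
  have [_ /(_ _ Vi)[Vf gf] _ _] := fg i.
  by rewrite (glueE _ _ V _ _ i)// (glueE _ _ U _ _ i)//; split => //; right; exists i.
- apply: (cglue _ _ _ V) => // i z Pz; have [a b c d] := fg i; last exact: c.
  by case: (a _ Pz).
- apply: (cglue _ _ _ U) => // i z Pz; have [a b c d] := fg i; last exact: d.
  by case: (b _ Pz).
Unshelve. all: by end_near. Qed.

Record ranked (X : topologicalType) (rho : X -> nat) : Prop := Ranked {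
  ranked_compact : compact [set: X];
  ranked_hausdorff : hausdorff_space X;
  ranked_clopen : forall (x : X) W, nbhs x W -> exists C, [/\ clopen C, C x & C `<=` W];
  ranked_countable : countable [set: X];
  ranked_lt : forall x, \forall y \near x, y = x \/ (rho y < rho x)%N;
  ranked_pred : forall x W, nbhs x W -> (0 < rho x)%N ->
    exists2 y, W y & rho y = (rho x).-1 }.

Section Ranked.
Variables (X : topologicalType) (rho : X -> nat).
Hypothesis rX : ranked rho.

Definition is_top (R : set X) (x : X) : Prop :=
  R x /\ forall z, R z -> z <> x -> (rho z < rho x)%N.

Lemma is_top_nbhs (x : X) (W : set X) : nbhs x W ->
  exists C, [/\ clopen C, C `<=` W & is_top C x].
Proof.
move=> xW; have [C [clC Cx CW]] := ranked_clopen rX (filterI xW (ranked_lt rX x)).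
exists C; split => // [z /CW[]//|]; split => // z /CW[_ []//].
Qed.

Lemma nbhs_clopenD1 (R : set X) (x t : X) : clopen R -> R t -> t <> x -> nbhs t (R `\ x).
Proof.
move=> [oR _] Rt tx; apply: open_nbhs_nbhs; split => //; apply: openI => //.
by apply: closed_openC; apply: accessible_closed_set1; apply: hausdorff_accessible; case: rX.
Qed.

(** If t has rank [(rho x).-1] it serves as the top z of the new piece. If its rank is smaller, z
    comes from [ranked_pred] and a clopen neighbourhood of t, too low in rank to compete with z, is
    added to that of z. *)
Lemma split_top (R : set X) (x t : X) : clopen R -> is_top R x -> (0 < rho x)%N ->
  exists Vz : set X * X, [/\ clopen Vz.1, Vz.1 `<=` R `\ x, is_top Vz.1 Vz.2,
    rho Vz.2 = (rho x).-1 & R t -> t <> x -> Vz.1 t].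
Proof.
move=> clR [Rx topR] x0.
have [Ct [clCt CtR Ctlt Ctt]] : exists C, [/\ clopen C, C `<=` R `\ x,
    forall w, C w -> (rho w < (rho x).-1)%N &
    R t -> t <> x -> (rho t < (rho x).-1)%N -> C t].
  have [[Rt tx tlt]|nt] := pselect [/\ R t, t <> x & (rho t < (rho x).-1)%N].
    have [C [clC CR topC]] := is_top_nbhs (nbhs_clopenD1 clR Rt tx).
    exists C; split => //; last by move=> _ _ _; case: topC.
    move=> w Cw; have [->//|/eqP wt] := eqVneq w t.
    exact: ltn_trans (topC.2 _ Cw wt) tlt.
  exists set0; split => //; first exact: clopen0.
  by move=> Rt tx tlt; apply: nt.
have [z [Rz zx rz tz]] : exists z, [/\ R z, z <> x, rho z = (rho x).-1 &
    R t -> t <> x -> (rho x).-1 <= rho t -> t = z]%N.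
  have [[Rt tx tlt]|nt] := pselect [/\ R t, t <> x & ((rho x).-1 <= rho t)%N].
    exists t; split => //; apply/eqP; rewrite eqn_leq tlt andbT.
    by have := topR _ Rt tx; lia.
  have nR : nbhs x R by apply: open_nbhs_nbhs; split => //; case: clR.
  have [z Rz rz] := ranked_pred rX nR x0.
  exists z; split => // [zx|Rt tx tlt]; last by case: nt.
  by move: rz; rewrite zx; lia.
have [C [clC CR topC]] := is_top_nbhs (nbhs_clopenD1 clR Rz zx).
exists (C `|` Ct, z); split => //=.
- exact: clopenU.
- by move=> w [/CR|/CtR].
- split; first by left; case: topC.
  by move=> w [Cw|/Ctlt]; [exact: (topC.2)|rewrite rz].
- move=> Rt tx; case: (ltnP (rho t) (rho x).-1) => [tl|/(tz Rt tx) ->].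
    by right; exact: Ctt.
  by left; case: topC.
Qed.

(* The pieces are cut off greedily along an enumeration t of X: the i-th piece
   swallows t i, so the pieces exhaust R minus x. *)
Lemma top_decomposition (R : set X) (x : X) : clopen R -> is_top R x -> (0 < rho x)%N ->
  exists (V : nat -> set X) (z : nat -> X),
  [/\ forall i, clopen (V i), forall i, is_top (V i) (z i) /\ rho (z i) = (rho x).-1,
      trivIset setT V, forall i, ~ V i x & R = x |` \bigcup_i V i].
Proof.
move=> clR topR x0.
have [t tP] : exists t : nat -> X, forall y, exists i, t i = y.
  have /countable_injP[e einj] := ranked_countable rX.
  exists (fun i => xget x [set y | e y = i]) => y; exists (e y).
  by apply: xget_unique => // w /= ew; apply: einj => //; rewrite inE.
have /choice[S SP] : forall Rt : set X * X, exists Vz : set X * X,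
    clopen Rt.1 -> is_top Rt.1 x ->
    [/\ clopen Vz.1, Vz.1 `<=` Rt.1 `\ x, is_top Vz.1 Vz.2,
    rho Vz.2 = (rho x).-1 & Rt.1 Rt.2 -> Rt.2 <> x -> Vz.1 Rt.2].
  move=> [R' t']; have [[clR' topR']|n] := pselect (clopen R' /\ is_top R' x).
    by have [Vz VzP] := split_top t' clR' topR' x0; exists Vz.
  by exists (R', t') => clR' topR'; case: n.
(* [Q i] is what is left of R after i cuts; x stays in it as the only point of maximal rank, so the
   cutting never stops. *)
pose Q := fix Q i := if i is j.+1 then Q j `\` (S (Q j, t j)).1 else R.
have QP i : clopen (Q i) /\ is_top (Q i) x.
  elim: i => [//|i [clQ topQ]] /=.
  have [clV VQ topV rV _] := SP (Q i, t i) clQ topQ.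
  split; first by apply: clopenI => //; apply: clopenC.
  split; first by split; [case: topQ|move=> /VQ[_ /=]].
  by move=> z [Qz _]; apply: topQ.2.
pose V i := (S (Q i, t i)).1.
have VP i := SP (Q i, t i) (QP i).1 (QP i).2.
have Qle i j : (i <= j)%N -> Q j `<=` Q i.
  elim: j => [|j IH]; first by rewrite leqn0 => /eqP ->.
  by rewrite leq_eqVlt ltnS => /predU1P[->//|/IH ij] w [/ij].
have dV i j w : (i < j)%N -> V i w -> V j w -> False.
  move=> ij Vi; have [_ VQ _ _ _] := VP j.
  by move=> /VQ[/= /(Qle _ _ ij)[_ ]].
exists V, (fun i => (S (Q i, t i)).2); split.
- by move=> i; case: (VP i).
- by move=> i; case: (VP i).
- move=> i j _ _ [w [Vi Vj]]; case: (ltngtP i j) => // [ij|ij].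
    by case: (dV _ _ _ ij Vi Vj).
  by case: (dV _ _ _ ij Vj Vi).
- by move=> i; have [_ VQ _ _ _] := VP i; move=> /VQ[_ /=].
- apply/seteqP; split => [w Rw|w [->|[i _]]]; last 2 first.
  + by case: topR.
  + by have [_ VQ _ _ _] := VP i; move=> /VQ[/= /(Qle 0 i isT)].
  have [->|/eqP wx] := eqVneq w x; first by left.
  right; have [i ti] := tP w; apply: contrapT => nV.
  have Qw j : Q j w.
    by elim: j => //= j Qj; split => //; move=> Vj; apply: nV; exists j.
  have [_ _ _ _ VQ] := VP i; apply: nV; exists i => //.
  by rewrite -ti; apply: VQ; rewrite ti.
Qed.

(** The complement in R of an open neighbourhood of x is compact and covered by the disjoint open V
    i, so it meets only finitely many of them. *)
Lemma bouquet_converges_to (R : set X) (x : X) (V : nat -> set X) :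
  clopen R -> (forall i, clopen (V i)) -> trivIset setT V ->
  R = x |` \bigcup_i V i -> converges_to V x.
Proof.
move=> clR clV tV RE W; rewrite nbhsE => -[O [oO Ox] OW].
have cK : compact (R `\` O).
  apply: subclosed_compact (ranked_compact rX) _ => //.
  by apply: closedI; [case: clR|exact: open_closedC].
move/compact_near_coveringP: cK => /(_ nat \oo (fun i z => ~ V i z) _).
case=> [z [Rz Oz]|N _ NP].
  move: Rz; rewrite RE => -[zx|[j _ Vj]]; first by rewrite zx in Oz.
  exists (V j, [set i | j < i]%N) => /=.
    split; last by exists j.+1.
    by apply: open_nbhs_nbhs; split => //; case: (clV j).
  move=> [w i] /= [Vw ji] Vi; have ij : i = j by apply: tV => //; exists w.
  by rewrite ij ltnn in ji.
exists N => i Ni w Vi; apply: contrapT => nW.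
apply: (NP i Ni w) => //; split; last by move=> /OW.
by rewrite RE; right; exists i.
Qed.

End Ranked.

Lemma homeo_on_top (X Y : topologicalType) (rho : X -> nat) (sigma : Y -> nat) :
  ranked rho -> ranked sigma -> forall (R : set X) (S : set Y) x y,
  clopen R -> clopen S -> is_top rho R x -> is_top sigma S y ->
  rho x = sigma y -> homeo_on R S.
Proof.
move=> rX rY R S x y; move rx : (rho x) => h.
elim: h R S x y rx => [|h IH] R S x y rx clR clS topR topS ry.
  have single (Z : topologicalType) (tau : Z -> nat) (T : set Z) z :
      is_top tau T z -> tau z = 0%N -> forall w, T w -> w = z.
    by move=> [Tz topT] tz w Tw; apply: contrapT => /(topT _ Tw); rewrite tz.
  have Rx := single _ _ _ _ topR rx; have Sy := single _ _ _ _ topS (esym ry).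
  exists (fun=> y), (fun=> x); split.
  - by move=> w /Rx ->; split => //; case: topS.
  - by move=> w /Sy ->; split => //; case: topR.
  - by move=> w _; apply: cst_continuous.
  - by move=> w _; apply: cst_continuous.
have x0 : (0 < rho x)%N by rewrite rx.
have y0 : (0 < sigma y)%N by rewrite -ry.
have [V [v [clV topV tV nV RE]]] := top_decomposition rX clR topR x0.
have [W [w [clW topW tW nW SE]]] := top_decomposition rY clS topS y0.
have nR : nbhs x R by apply: open_nbhs_nbhs; split; [case: clR|case: topR].
have nS : nbhs y S by apply: open_nbhs_nbhs; split; [case: clS|case: topS].
rewrite RE SE in nR nS *; apply: homeo_on_bouquet => //.
- exact: (bouquet_converges_to rX clR).
- exact: (bouquet_converges_to rY clS).
- move=> i; have [topVi rv] := topV i; have [topWi rw] := topW i.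
  by apply: (IH _ _ (v i) (w i)) => //; rewrite ?rv ?rw ?rx -?ry.
Qed.

Definition enumerates_top (X : topologicalType) (rho : X -> nat) (h : nat)
    (R : set X) (s : seq X) : Prop :=
  [/\ uniq s, forall z, R z -> (rho z <= h)%N &
      forall z, z \in s <-> R z /\ rho z = h].

(** Top points are cut off one by one, each with a clopen neighbourhood in which it is alone; the
    last one takes all that remains. The lists are nonempty because otherwise nothing would absorb
    the points of lower rank. *)
Lemma homeo_on_tops (X Y : topologicalType) (rho : X -> nat) (sigma : Y -> nat)
    h (R : set X) (S : set Y) x s y t :
  ranked rho -> ranked sigma -> clopen R -> clopen S -> size s = size t ->
  enumerates_top rho h R (x :: s) -> enumerates_top sigma h S (y :: t) ->
  homeo_on R S.
Proof.
move=> rX rY; elim: s x y t R S => [|x' s IH] x y [|y' t] R S //= clR clS sz eR eS.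
  have single (Z : topologicalType) (tau : Z -> nat) (T : set Z) z :
      enumerates_top tau h T [:: z] -> is_top tau T z /\ tau z = h.
    move=> [_ le eT]; have [Tz tz] := (eT z).1 (mem_head _ _).
    split => //; split => // w Tw wz; rewrite ltn_neqAle tz le // andbT.
    apply/eqP => tw; apply: wz; have := (eT w).2 (conj Tw tw).
    by rewrite inE => /eqP.
  have [topR rx] := single _ _ _ _ eR; have [topS ry] := single _ _ _ _ eS.
  by apply: (homeo_on_top rX rY clR clS topR topS); rewrite rx.
have cut (Z : topologicalType) (tau : Z -> nat) (T : set Z) z z' u :
    ranked tau -> clopen T -> enumerates_top tau h T (z :: z' :: u) ->
    exists C, [/\ clopen C, is_top tau C z, tau z = h, C `<=` T &
      enumerates_top tau h (T `\` C) (z' :: u)].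
  move=> rZ clT [/= /andP[zu uu] le eT].
  have [Tz tz] := (eT z).1 (mem_head _ _).
  have nT : nbhs z T by apply: open_nbhs_nbhs; split => //; case: clT.
  have [C [clC CT topC]] := is_top_nbhs rZ nT.
  exists C; split => //; split => // [w [/le]//|w]; split.
    move=> wu; have [|Tw tw] := (eT w).1; first by rewrite inE wu orbT.
    split => //; split => // Cw; have := topC.2 w Cw; rewrite tw tz ltnn.
    by case/(_ _)/notF => // wz; rewrite -wz wu in zu.
  move=> [[Tw nCw] tw]; have := (eT w).2 (conj Tw tw); rewrite inE.
  by case/predU1P => // wz; case: nCw; rewrite wz; case: topC.
have [C [clC topC rx CR eC]] := cut _ _ _ _ _ _ rX clR eR.
have [D [clD topD ry DS eD]] := cut _ _ _ _ _ _ rY clS eS.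
have clRC : clopen (R `\` C) by apply: clopenI => //; apply: clopenC.
have clSD : clopen (S `\` D) by apply: clopenI => //; apply: clopenC.
rewrite -(setDUK CR) -(setDUK DS); apply: homeo_onU.
- by case: clC.
- by case: clRC.
- by case: clD.
- by case: clSD.
- by rewrite setDE setIA setIAC setICr set0I.
- by rewrite setDE setIA setIAC setICr set0I.
- by apply: (homeo_on_top rX rY clC clD topC topD); rewrite rx ry.
- by apply: IH eC eD => //; case: sz.
Qed.

Lemma ranked_homeomorphic (X Y : topologicalType) (rho : X -> nat)
    (sigma : Y -> nat) h s t :
  ranked rho -> ranked sigma -> (0 < size s)%N -> size s = size t ->
  enumerates_top rho h setT s -> enumerates_top sigma h setT t ->
  homeomorphic X Y.
Proof.
case: s t => [|x s] [|y t] //= rX rY _ [sz] eX eY.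
have [f [g [fK gK cf cg]]] := homeo_on_tops rX rY clopenT clopenT sz eX eY.
exists f, g; split => [z|z|z|z].
- by case: (fK z).
- by case: (gK z).
- exact: cf.
- exact: cg.
Qed.

(** * The spaces D^h x [n] *)

(** The sets containing a cylinder around d form a filter that converges to d in each coordinate,
    hence in the product. *)
Lemma nbhs_prod_topology (I : eqType) (K : topologicalType)
    (d : prod_topology (fun _ : I => K)) (W : set (prod_topology (fun _ : I => K))) :
  nbhs d W -> exists (s : seq I) (O : I -> set K),
    (forall i, nbhs (d i) (O i)) /\
    (forall e : prod_topology (fun _ : I => K), (forall i, i \in s -> O i (e i)) -> W e).
Proof.
pose F : set_system (prod_topology (fun _ : I => K)) := [set V |
  exists (s : seq I) (O : I -> set K), (forall i, nbhs (d i) (O i)) /\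
    (forall e : prod_topology (fun _ : I => K), (forall i, i \in s -> O i (e i)) -> V e)].
have FF : Filter F.
  split.
  - by exists [::], (fun=> setT); split => // i; apply: filterT.
  - move=> P Q [s [O [Od OP]]] [t [O' [O'd O'Q]]].
    exists (s ++ t), (fun i => O i `&` O' i); split=> [i|e eO]; first exact: filterI.
    by split; [apply: OP|apply: O'Q] => i si; have [] := eO i; rewrite ?mem_cat ?si ?orbT.
  - by move=> P Q PQ [s [O [Od OP]]]; exists s, O; split => // e /OP/PQ.
suff cF : F --> d by move=> /cF.
apply/cvg_sup => i A [_ [[B oB <-] Bd] BA].
exists [:: i], (fun j => if j == i then B else setT); split=> [j|e].
  by case: eqP => [->|_]; [apply: open_nbhs_nbhs|apply: filterT].
by move=> /(_ i); rewrite mem_head eqxx => /(_ isT) /BA.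
Qed.

Lemma compact_zero_dimensional_clopen (X : topologicalType) :
  compact [set: X] -> hausdorff_space X -> zero_dimensional X ->
  forall (x : X) W, nbhs x W -> exists C, [/\ clopen C, C x & C `<=` W].
Proof.
move=> cX hX zX x W /(zero_dimensional_cvg hX zX cX)[C [Cx clC] CW].
by exists C.
Qed.

Lemma D_hausdorff : hausdorff_space D.
Proof.
apply: one_point_compactification_hausdorff; last exact: discrete_hausdorff.
move=> k _; rewrite withinET; exists [set k]; first exact: discrete_set1.
by split; [exact: compact_set1|exact: discrete_closed].
Qed.

Lemma D_nbhs_Some (k : nat) : nbhs (Some k : D) [set Some k].
Proof.
have <- : Some @` [set k] = [set (Some k : D)] by exact: image_set1.
exact: (@one_point_compactification_some_nbhs nat k [set k] (discrete_set1 k)).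
Qed.

Lemma D_clopen_Some (k : nat) : clopen [set (Some k : D)].
Proof.
split; first by rewrite openE => _ -> ; exact: D_nbhs_Some.
by apply: accessible_closed_set1; apply: hausdorff_accessible; exact: D_hausdorff.
Qed.

(** A compact set of the discrete space [nat] is bounded, so its complement contains integers. *)
Lemma D_nbhs_None (O : set D) : nbhs (None : D) O -> exists k : nat, O (Some k).
Proof.
move=> [K [cK _] KO]; suff [k nKk] : exists k, ~ K k by exists k; apply: KO; left; exists k.
move/compact_near_coveringP: cK => /(_ nat \oo (fun i z => z <> i) _).
case=> [z _|N _ /(_ N)].
  exists ([set z], [set i | z < i]%N) => /=; first by split; [exact: discrete_set1|exists z.+1].
  by move=> [w i] /= [->] zi /eqP; rewrite ltn_eqF.
by move=> /(_ (leqnn N)) NP; exists N => /NP.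
Qed.

Lemma D_zero_dimensional : zero_dimensional D.
Proof.
move=> [k|] y ky.
  exists [set Some k]; split => //; first exact: D_clopen_Some.
  by move=> /= /esym/eqP; apply/negP.
case: y ky => [k _|//]; exists (~` [set Some k]); split => //.
- exact: (clopenC set0 (D_clopen_Some k)).
- by move=> /(_ erefl).
Qed.

Lemma D_pow_hausdorff h : hausdorff_space (D_pow h).
Proof. by apply: hausdorff_product => _; exact: D_hausdorff. Qed.

Lemma D_pow_compact h : compact [set: D_pow h].
Proof.
have := @tychonoff 'I_h (fun=> D) (fun=> setT) (fun=> one_point_compactification_compact).
by congr compact; apply/seteqP.
Qed.

Lemma D_pow_zero_dimensional h : zero_dimensional (D_pow h).
Proof. by apply: zero_dimension_prod => _; exact: D_zero_dimensional. Qed.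

Definition nb_infinite h n (y : D_pow h * discrete_ord n) : nat :=
  #|[pred i : 'I_h | (y.1 i : option nat) == None]|.

(** Finite points of D are isolated, so near x the finite coordinates are frozen: infinite
    coordinates of y are infinite in x, and if there are as many of them then y = x. To lose exactly
    one, replace an infinite coordinate by an integer close to infinity. *)
Lemma ranked_nb_infinite h n : ranked (@nb_infinite h n).
Proof.
have cY : compact [set: D_pow h * discrete_ord n].
  rewrite -setXTT; apply: compact_setX; first exact: D_pow_compact.
  rewrite compact_near_coveringP => I F P FF /(_ _ Logic.I) nP.
  have : \forall i \near F, forall j : 'I_n, P i j.
    apply: filter_forall => j; have [[A B] /= [Aj FB] AB] := nP j.
    apply: filterS FB => i Bi; apply: (AB (j, i)); split => //=.
    exact: nbhs_singleton Aj.
  by apply: filterS => i Pi j _; apply: Pi.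
have hY : hausdorff_space (D_pow h * discrete_ord n)%type.
  move=> [x1 x2] [y1 y2] cxy; congr pair.
    apply: (@D_pow_hausdorff h) => U V Ux Vy.
    have [||z [Uz Vz]] := cxy (fst @^-1` U) (fst @^-1` V); last by exists z.1.
    - by exists (U, setT) => [|[a b] []//]; split => //; exact: filterT.
    - by exists (V, setT) => [|[a b] []//]; split => //; exact: filterT.
  apply: (@discrete_hausdorff (discrete_topology 'I_n)) => U V Ux Vy.
  have [||z [Uz Vz]] := cxy (snd @^-1` U) (snd @^-1` V); last by exists z.2.
  - by exists (setT, U) => [|[a b] []//]; split => //; exact: filterT.
  - by exists (setT, V) => [|[a b] []//]; split => //; exact: filterT.
split => //.
- apply: compact_zero_dimensional_clopen => // -[x1 x2] [y1 y2] xy.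
  have [e1|/D_pow_zero_dimensional[U [clU Ux Uy]]] := eqVneq x1 y1.
    exists (snd @^-1` [set x2]); split => //=.
    + apply: preimage_clopen; last by move=> z; exact: cvg_snd.
      by split; [exact: discrete_open|exact: discrete_closed].
    + by move=> e2; move: xy; rewrite e1 e2 eqxx.
  exists (fst @^-1` U); split => //=.
  by apply: preimage_clopen => // z; exact: cvg_fst.
- apply/countable_injP.
  exists (fun y => pickle ([ffun i => y.1 i : option nat], y.2 : 'I_n)).
  move=> [x1 x2] [y1 y2] _ _ /(pcan_inj pickleK)[] /ffunP e1 ->; congr pair.
  by apply: functional_extensionality_dep => i; have := e1 i; rewrite !ffunE.
- move=> x.
  have nf1 (i : 'I_h) : nbhs (x.1 : D_pow h)
      [set y : D_pow h | (x.1 i : option nat) != None -> y i = x.1 i].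
    have [xi|] := eqVneq (x.1 i : option nat) None.
      suff -> : [set y : D_pow h | ~~ true -> y i = x.1 i] = setT by exact: filterT.
      by apply/seteqP; split.
    case xi: (x.1 i) => [k|//] _.
    suff -> : [set y : D_pow h | ~~ false -> y i = Some k] = proj i @^-1` [set Some k].
      by apply: (@proj_continuous 'I_h (fun=> D) i x.1); rewrite /proj xi; exact: D_nbhs_Some.
    by apply/seteqP; split => y /= yk //; apply: yk.
  have nf : \forall y \near x.1, forall i, (x.1 i : option nat) != None -> y i = x.1 i.
    exact: (filter_forall (F := nbhs (x.1 : D_pow h))).
  have nx : \forall y \near x, y.2 = x.2 /\
      forall i, (x.1 i : option nat) != None -> y.1 i = x.1 i.
    exists ([set y | forall i, (x.1 i : option nat) != None -> y i = x.1 i],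
      [set x.2]) => [|[a b] /= []//]; split => //; exact: discrete_set1.
  apply: filterS nx => y [yx2 yx].
  have sub : {subset [pred i | (y.1 i : option nat) == None] <=
                     [pred i | (x.1 i : option nat) == None]}.
    by move=> i; rewrite !inE; apply: contraTT => xi; rewrite yx.
  have [le|lt] := ltnP (nb_infinite y) (nb_infinite x); [by right|left].
  have [_ e] := subset_leqif_card (introT fintype.subsetP sub).
  have eqc : #|[pred i | (y.1 i : option nat) == None]| ==
             #|[pred i | (x.1 i : option nat) == None]|.
    by rewrite eqn_leq lt andbT; apply: subset_leq_card; apply/fintype.subsetP.
  move: e; rewrite eqc => /esym/fintype.subsetP sub'.
  case: x y yx2 yx sub' {sub lt eqc nf nf1} => x1 x2 [y1 y2] /= -> yx sub'; congr pair.
  apply: functional_extensionality_dep => i.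
  have [xi|/yx//] := eqVneq (x1 i : option nat) None.
  by rewrite xi; have := sub' i; rewrite !inE xi eqxx => /(_ isT)/eqP.
- move=> [x1 x2] W [[P Q] /= [Px Qx] PQ] /card_gt0P[i]; rewrite inE /= => /eqP xi.
  have [s [O [Ox OP]]] := nbhs_prod_topology Px.
  have := Ox i; rewrite xi => /D_nbhs_None[k Ok].
  exists ((fun j => if j == i then Some k else x1 j), x2).
    apply: PQ; split => /=; last exact: nbhs_singleton.
    by apply: OP => j _; case: eqP => [->//|_]; apply: nbhs_singleton.
  rewrite /nb_infinite /= [in RHS](cardD1 i) inE /= xi eqxx add1n /=.
  by apply: eq_card => j; rewrite !inE; case: (j =P i).
Qed.

Lemma enumerates_top_nb_infinite h n :
  enumerates_top (@nb_infinite h n) h setT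
    [seq ((fun=> None) : D_pow h, j : discrete_ord n) | j <- enum 'I_n].
Proof.
split.
- by rewrite map_inj_uniq ?enum_uniq // => i j [].
- by move=> y _; rewrite -[leqRHS]card_ord; apply: max_card.
- move=> y; split.
    case/mapP => j _ ->; split => //; rewrite /nb_infinite /= -[RHS]card_ord.
    by apply: eq_card => i; rewrite !inE eqxx.
  move=> [_ yh]; apply/mapP; exists y.2; first by rewrite mem_enum.
  rewrite [LHS]surjective_pairing; congr pair.
  apply: functional_extensionality_dep => i; apply/eqP; move: yh.
  rewrite /nb_infinite -[RHS]card_ord => /eqP.
  have [_ ->] := subset_leqif_card (subset_predT [pred i | (y.1 i : option nat) == None]).
  by move=> /fintype.subsetP/(_ i isT).
Qed.

(** * Subgroups and the descending chain condition *)

Inductive zexpr :=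
  | ZVar of nat | ZZero | ZAdd of zexpr & zexpr | ZOpp of zexpr | ZMul of zexpr & int.

Fixpoint zeval (A : zmodType) (env : seq A) e : A :=
  match e with
  | ZVar n => env`_n
  | ZZero => 0
  | ZAdd e1 e2 => zeval env e1 + zeval env e2
  | ZOpp e1 => - zeval env e1
  | ZMul e1 k => zeval env e1 *~ k
  end.

Fixpoint zcoef e (i : nat) : int :=
  match e with
  | ZVar n => if n == i then 1 else 0
  | ZZero => 0
  | ZAdd e1 e2 => zcoef e1 i + zcoef e2 i
  | ZOpp e1 => - zcoef e1 i
  | ZMul e1 k => zcoef e1 i * k
  end.

Lemma zeval_coef (A : zmodType) (env : seq A) e :
  zeval env e = \sum_(i < size env) env`_i *~ zcoef e i.
Proof.
elim: e => [n||e1 IH1 e2 IH2|e1 IH1|e1 IH1 k] /=.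
- have [nlt|nge] := ltnP n (size env).
    rewrite (bigD1 (Ordinal nlt)) //= eqxx mulr1z big1 ?addr0 // => i.
    by rewrite -val_eqE /= eq_sym => /negPf ->; rewrite mulr0z.
  rewrite nth_default // big1 // => i _.
  by rewrite gtn_eqF ?mulr0z // (leq_trans _ nge).
- by rewrite big1 // => i _; rewrite mulr0z.
- by rewrite IH1 IH2 -big_split; apply: eq_bigr => i _; rewrite mulrzDr.
- by rewrite IH1 -sumrN; apply: eq_bigr => i _; rewrite mulrNz.
- by rewrite IH1 mulrz_suml; apply: eq_bigr => i _; rewrite mulrzA.
Qed.

Lemma zeval_eq (A : zmodType) (env : seq A) e1 e2 :
  foldr (fun i P => zcoef e1 i = zcoef e2 i /\ P) True (iota 0 (size env)) ->
  zeval env e1 = zeval env e2.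
Proof.
move=> coefs; rewrite !zeval_coef; apply: eq_bigr => i _; congr (_ *~ _).
have : nat_of_ord i \in iota 0 (size env) by rewrite mem_iota /= add0n.
by elim: (iota _ _) coefs => //= j s IH [eqj /IH {}IH]; rewrite inE => /predU1P[->|].
Qed.

(* [zmod] proves an equation between Z-linear combinations in an abelian group
   by comparing the coefficients of each atom. *)
Ltac zmod_index x env :=
  lazymatch env with
  | x :: _ => constr:(0%N)
  | _ :: ?env' => let n := zmod_index x env' in constr:(S n)
  end.
Ltac zmod_mem x env :=
  lazymatch env with
  | [::] => constr:(false)
  | x :: _ => constr:(true)
  | _ :: ?env' => zmod_mem x env'
  end.
Ltac zmod_atoms t env :=
  lazymatch t with
  | @GRing.zero _ => env
  | @GRing.add _ ?a ?b => let env1 := zmod_atoms a env in zmod_atoms b env1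
  | @GRing.opp _ ?a => zmod_atoms a env
  | @intmul _ ?a _ => zmod_atoms a env
  | @GRing.natmul _ ?a _ => zmod_atoms a env
  | _ => lazymatch zmod_mem t env with
         | true => env
         | false => constr:(t :: env)
         end
  end.
Ltac zmod_reify t env :=
  lazymatch t with
  | @GRing.zero _ => constr:(ZZero)
  | @GRing.add _ ?a ?b =>
      let a' := zmod_reify a env in let b' := zmod_reify b env in constr:(ZAdd a' b')
  | @GRing.opp _ ?a => let a' := zmod_reify a env in constr:(ZOpp a')
  | @intmul _ ?a ?k => let a' := zmod_reify a env in constr:(ZMul a' k)
  | @GRing.natmul _ ?a ?k => let a' := zmod_reify a env in constr:(ZMul a' (Posz k))
  | _ => let n := zmod_index t env in constr:(ZVar n)
  end.
Ltac zmod :=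
  lazymatch goal with
  | |- @eq ?T ?a ?b =>
      let env := zmod_atoms a (@nil T) in
      let env := zmod_atoms b env in
      let e1 := zmod_reify a env in
      let e2 := zmod_reify b env in
      refine (@zeval_eq _ env e1 e2 _); cbn [foldr iota size zcoef eqn eq_op];
      simpl; repeat split;
      solve [repeat match goal with H : _ |- _ => clear H end; lia | lia]
  end.

Section SubgroupBasics.
Variable A : zmodType.
Implicit Types (H K Z : subgroups A) (x y z : A) (s : seq A).

Lemma subgroup_ext H K : H =i K -> H = K.
Proof. by move=> HK; apply: val_inj; apply/funext => x; have := HK x. Qed.

Fact adjoin_closed H z :
  zmod_closed (fun x => `[< exists k : int, x - z *~ k \in H >]).
Proof.
split=> [|x y]; first by apply/asboolP; exists 0; rewrite mulr0z subr0 rpred0.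
move=> /asboolP[k xk] /asboolP[l yl]; apply/asboolP; exists (k - l).
have -> : x - y - z *~ (k - l) = (x - z *~ k) - (y - z *~ l) by zmod.
exact: rpredB.
Qed.

Definition adjoin H z : subgroups A := Subgroup (adjoin_closed H z).

Lemma mem_adjoin H z x : reflect (exists k : int, x - z *~ k \in H) (x \in adjoin H z).
Proof. exact: (@asboolP (exists k : int, x - z *~ k \in H)). Qed.

Lemma sub_adjoin H z : {subset H <= adjoin H z}.
Proof. by move=> x xH; apply/mem_adjoin; exists 0; rewrite mulr0z subr0. Qed.

Lemma adjoin_self H z : z \in adjoin H z.
Proof. by apply/mem_adjoin; exists 1; rewrite mulr1z subrr rpred0. Qed.

Lemma adjoin_sub H K z : {subset H <= K} -> z \in K -> {subset adjoin H z <= K}.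
Proof.
move=> HK zK x /mem_adjoin[k /HK xk].
have -> : x = (x - z *~ k) + z *~ k by zmod.
by rewrite rpredD // rpredMz.
Qed.

Definition adjoins H s : subgroups A := foldr (fun z K => adjoin K z) H s.

Lemma mem_adjoins H s : {subset s <= adjoins H s}.
Proof.
elim: s => //= z s IH x; rewrite inE => /predU1P[->|/IH]; first exact: adjoin_self.
exact: sub_adjoin.
Qed.

Lemma adjoins_sub H K s : {subset H <= K} -> {subset s <= K} ->
  {subset adjoins H s <= K}.
Proof.
move=> HK; elim: s => //= z s IH sK; apply: adjoin_sub; last exact/sK/mem_head.
by apply: IH => x xs; apply: sK; rewrite inE xs orbT.
Qed.

Fact triv_closed : zmod_closed (fun x : A => `[< x = 0 >]).
Proof.
split=> [|x y /asboolP -> /asboolP ->]; apply/asboolP => //.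
by rewrite subr0.
Qed.

Definition span s : subgroups A := adjoins (Subgroup triv_closed) s.

Lemma mem_span s : {subset s <= span s}. Proof. exact: mem_adjoins. Qed.

Lemma span_sub s K : {subset s <= K} -> {subset span s <= K}.
Proof. by apply: adjoins_sub => x /asboolP ->; apply: rpred0. Qed.

Lemma finitely_generatedE Z : finitely_generated Z -> exists s, Z =i span s.
Proof.
move=> [s sZ]; exists s => x; apply/idP/idP.
  by move=> /sZ; apply; apply: mem_span.
by move=> xs; apply/sZ => H sH; apply: span_sub sH _ xs.
Qed.

Fact mulset_closed H (n : nat) :
  zmod_closed (fun x => `[< exists2 y, y \in H & x = y *+ n >]).
Proof.
split=> [|_ _ /asboolP[x xH ->] /asboolP[y yH ->]]; apply/asboolP.
  by exists 0; rewrite ?rpred0 ?mul0rn.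
by exists (x - y); rewrite ?rpredB ?mulrnBl.
Qed.

Fact sum_closed H K :
  zmod_closed (fun x => `[< exists2 y, y \in H & x - y \in K >]).
Proof.
split=> [|x y /asboolP[x' xH xK] /asboolP[y' yH yK]]; apply/asboolP.
  by exists 0; rewrite ?subr0 rpred0.
exists (x' - y'); first exact: rpredB.
have -> : x - y - (x' - y') = (x - x') - (y - y') by zmod.
exact: rpredB.
Qed.

Fact setI_closed_subgroup H K : zmod_closed (fun x => `[< x \in H /\ x \in K >]).
Proof.
split=> [|x y /asboolP[xH xK] /asboolP[yH yK]]; apply/asboolP.
  by rewrite !rpred0.
by rewrite !rpredB.
Qed.

Definition cap H K : subgroups A := Subgroup (setI_closed_subgroup H K).

Lemma mem_cap H K x : (x \in cap H K) = (x \in H) && (x \in K).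
Proof. by apply/asboolP/andP. Qed.

Lemma rpred_gcd H x (m n : nat) :
  x *+ m \in H -> x *+ n \in H -> x *+ gcdn m n \in H.
Proof.
have [->|m0] := posnP m; first by rewrite gcd0n.
move=> xm xn; have [u v e _] := egcdnP n m0.
have -> : x *+ gcdn m n = x *+ m *+ u - x *+ n *+ v by zmod.
by apply: rpredB; apply: rpredMn.
Qed.

Lemma rpred_coprime H x (m n : nat) :
  coprime m n -> x *+ m \in H -> x *+ n \in H -> x \in H.
Proof. by move=> /eqP mn xm xn; have := rpred_gcd xm xn; rewrite mn mulr1n. Qed.

Lemma rpred_absz H x (k : int) : (x *+ `|k|%N \in H) = (x *~ k \in H).
Proof. by case: k => n //=; rewrite NegzE /= mulrNz rpredN -pmulrn. Qed.

(** Turns a torsion element of A/H into a nonzero element of its socle, the only place where the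
    test elements used later can see it. *)
Lemma torsion_prime H x (n : nat) : (0 < n)%N -> x *+ n \in H -> x \notin H ->
  exists (i p : nat), [/\ prime p, (p %| n)%N, x *+ i \notin H & x *+ i *+ p \in H].
Proof.
elim/ltn_ind: n => n IH n0 xn xH.
have n1 : (1 < n)%N by case: n n0 xn {IH} => [|[|n]] //; rewrite mulr1n (negPf xH).
have pn := pdiv_dvd n; have pp := pdiv_prime n1.
have q0 : (0 < n %/ pdiv n)%N by rewrite divn_gt0 ?prime_gt0 // dvdn_leq.
have [xq|xq] := boolP (x *+ (n %/ pdiv n) \in H).
  have [|i [p [p_pr pdvd xi xip]]] := IH _ _ q0 xq xH.
    by rewrite ltn_Pdiv ?prime_gt1.
  by exists i, p; split => //; rewrite -(divnK pn) dvdn_mulr.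
by exists (n %/ pdiv n)%N, (pdiv n); split => //; rewrite -mulrnA divnK.
Qed.

End SubgroupBasics.

Definition mk_additive (A B : zmodType) (f : A -> B)
  (fB : forall x y, f (x - y) = f x - f y) : {additive A -> B} :=
  HB.pack f (GRing.isZmodMorphism.Build A B f fB).

Lemma quot_proj (A : zmodType) (H : subgroups A) :
  exists pi : {additive A -> Quotient.quot (subgroup_mem H)},
    (forall q, exists x, pi x = q) /\ forall x, (pi x == 0) = (x \in H).
Proof.
pose Q := Quotient.quot (subgroup_mem H).
pose f : A -> Q := (\pi_Q)%qT.
have piB : forall x y, f (x - y) = f x - f y by move=> x y; rewrite /f !piE.
exists (mk_additive piB); split=> [q|x]; first by exists (repr q); exact: reprK.
by rewrite -[x in RHS]subr0 Quotient.idealrBE /= /f !piE.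
Qed.

(** The Artinian condition on A/Z, read on the subgroups of A that contain Z. *)
Definition dcc (A : zmodType) (Z : subgroups A) : Prop :=
  forall u : nat -> subgroups A, (forall i, {subset Z <= u i}) ->
    (forall i, {subset u i.+1 <= u i}) ->
    exists N : nat, forall i, (N <= i)%N -> u i = u N.

Section DCC.
Variable A : zmodType.
Implicit Types (H K Z : subgroups A) (x y z : A).

Lemma artinian_dcc Z : artinian (Quotient.quot (subgroup_mem Z)) -> dcc Z.
Proof.
have [pi [pi_surj pi0]] := quot_proj Z.
move=> artA u Zu uS.
have im_closed H : zmod_closed (fun q => `[< exists2 x, x \in H & pi x = q >]).
  split=> [|_ _ /asboolP[x xH <-] /asboolP[y yH <-]]; apply/asboolP.
    by exists 0; rewrite ?rpred0 ?raddf0.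
  by exists (x - y); rewrite ?rpredB ?raddfB.
have [|N NP] := artA (fun i => Subgroup (im_closed (u i))).
  by move=> i q /asboolP[x /uS xH <-]; apply/asboolP; exists x.
have im_mem i x : (pi x \in Subgroup (im_closed (u i))) = (x \in u i).
  apply/asboolP/idP => [[y yu yx]|xu]; last by exists x.
  have -> : x = y + (x - y) by zmod.
  by rewrite rpredD // Zu // -pi0 raddfB yx subrr.
by exists N => i Ni; apply: subgroup_ext => x; rewrite -!im_mem NP.
Qed.

Lemma dcc_min Z (P : subgroups A -> Prop) : dcc Z ->
  (forall H, P H -> {subset Z <= H}) -> (exists H, P H) ->
  exists2 H, P H & forall K, P K -> {subset K <= H} -> K = H.
Proof.
move=> dccZ PZ [H0 PH0]; apply: contrapT => nmin.
have step (H : {H | P H}) :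
    {K : {H | P H} | {subset sval K <= sval H} /\ sval K <> sval H}.
  case: H => H PH /=; apply: cid; apply: contrapT => nK; apply: nmin.
  exists H => // K PK KH; apply: contrapT => KnH; apply: nK.
  by exists (exist _ K PK).
have [u [_ uS]] := dependent_choice step (exist _ H0 PH0).
have [|i|N NP] := dccZ (fun i => sval (u i)).
- by move=> i; apply: PZ; apply: svalP.
- by case: (uS i).
- by case: (uS N) => _; apply; rewrite NP.
Qed.

Lemma dcc_sub Z K : {subset Z <= K} -> dcc Z -> dcc K.
Proof. by move=> ZK dccZ u Ku uS; apply: dccZ => // i x /ZK/Ku. Qed.

(** The subgroups generated by Z and (i+1)! x decrease. Where they become stationary, (N+1)! (1 -
    (N+2)k) x lies in Z for some k, and the coefficient is nonzero because N+2 does not divide 1. *)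
Lemma dcc_torsion Z x : dcc Z -> exists2 n, (0 < n)%N & x *+ n \in Z.
Proof.
move=> dccZ; have [|i|N NP] := dccZ (fun i => adjoin Z (x *+ (i.+1)`!)).
- by move=> i; apply: sub_adjoin.
- apply: adjoin_sub; first exact: sub_adjoin.
  by rewrite factS mulnC mulrnA rpredMn ?adjoin_self.
have := adjoin_self Z (x *+ (N.+1)`!).
rewrite -(NP N.+1) // => /mem_adjoin[k].
set F := (N.+1)`!; have F0 : (0 < F)%N := fact_gt0 _.
rewrite factS -/F.
have -> : x *+ F - x *+ (N.+2 * F) *~ k = x *~ (F%:Z * (1 - N.+2%:Z * k)) by zmod.
rewrite -rpred_absz => xk; exists (absz (F%:Z * (1 - N.+2%:Z * k))) => //.
rewrite absz_gt0 mulf_neq0 //; first by rewrite eqz_nat -lt0n.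
apply/eqP => e; have : (N.+2%:Z %| 1)%Z by apply/dvdzP; exists k; lia.
by rewrite dvdzE /= dvdn1.
Qed.

End DCC.

(** * Quasicyclic groups *)

Definition divisible (V : zmodType) : Prop :=
  forall (v : V) n, (0 < n)%N -> exists w, w *+ n = v.

(** * Injectivity of divisible groups *)

Section HomExtension.
Variables (A V : zmodType) (H : subgroups A) (phi : A -> V).
Hypothesis divV : divisible V.
Hypothesis phiB : {in H &, forall x y, phi (x - y) = phi x - phi y}.

Definition additive_graph : set (A * V) := [set a | a.1 \in H /\ a.2 = phi a.1].

Definition functional_subgroup (G : set (A * V)) : Prop :=
  (forall a b, G a -> G b -> G (a.1 - b.1, a.2 - b.2)) /\ forall v, G (0, v) -> v = 0.

Lemma additive_on0 : phi 0 = 0.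
Proof. by have := phiB (rpred0 H) (rpred0 H); rewrite !subr0 subrr. Qed.

Lemma additive_graph_functional : functional_subgroup additive_graph.
Proof.
split=> [[a1 a2] [b1 b2] [/= aH ->] [/= bH ->]|v [_ /= ->]]; last exact: additive_on0.
by split => /=; [exact: rpredB|rewrite phiB].
Qed.

Lemma additive_graph0 : additive_graph (0, 0).
Proof. by split; rewrite ?rpred0 ?additive_on0. Qed.

(** If no positive multiple of x is in the domain, any value would do and 0 is taken. Otherwise let
    n be the least one and w0 its image: u is an n-th part of w0, and all multiples of x in the
    domain are multiples of n x. *)
Lemma functional_extend (G : set (A * V)) x : functional_subgroup G -> G (0, 0) ->
  exists u, forall k w, G (x *~ k, w) -> w = u *~ k.
Proof.
move=> [GB G0] G00.
have GN a : G a -> G (- a.1, - a.2) by move=> /(GB _ _ G00); rewrite /= !sub0r.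
have GD a b : G a -> G b -> G (a.1 + b.1, a.2 + b.2).
  by move=> Ga /GN Gb; have := GB _ _ Ga Gb; rewrite /= !opprK.
have GM a n : G a -> G (a.1 *+ n, a.2 *+ n).
  by move=> Ga; elim: n => [//|n IH]; rewrite !mulrSr; apply: (GD (_, _)).
have GZ a k : G a -> G (a.1 *~ k, a.2 *~ k).
  move=> Ga; case: k => n; first exact: GM.
  by rewrite NegzE !mulrNz; apply: (GN (_, _)); apply: GM.
have [[n0 Pn0]|nP] := pselect (exists n, (0 < n)%N /\ exists w, G (x *+ n, w)); last first.
  exists 0 => k w Gkw; rewrite mul0rz.
  have [k0|k0] := eqVneq k 0; first by apply: G0; rewrite k0 mulr0z in Gkw.
  case: nP; exists `|k|%N; rewrite absz_gt0 k0; split => //.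
  case: k k0 Gkw => n n_neq0 Gw; first by exists w.
  by exists (- w); move/GN: Gw; rewrite /= NegzE mulrNz opprK.
have ex : exists n, `[< (0 < n)%N /\ exists w, G (x *+ n, w) >].
  by exists n0; apply/asboolP.
have [n /asboolP[n_gt0 [w0 Gw0]] n_min] := ex_minnP ex.
have [u un] := divV w0 n_gt0; exists u => k w Gw.
have := GB _ _ Gw (GZ _ (k %/ n)%Z Gw0); rewrite /=.
have -> : x *~ k - x *+ n *~ (k %/ n)%Z = x *~ (k %% n)%Z.
  have := divz_eq k n; set q := (k %/ n)%Z; set r := (k %% n)%Z => ->.
  zmod.
have := modz_ge0 k (d := n%:Z) _; have := ltz_mod k (d := n%:Z) _.
have n_neq0 : n%:Z != 0 by rewrite eqz_nat -lt0n.
move=> /(_ n_neq0) rlt /(_ n_neq0); move: (divz_eq k n) rlt.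
case: (k %% n)%Z => // r kE rlt _ Gr.
have [r0|r0] := posnP r.
  rewrite r0 mulr0z in Gr; move/G0/eqP: Gr; rewrite subr_eq0 => /eqP ->.
  by move: kE; set q := (k %/ n)%Z => ->; rewrite -un r0; zmod.
have nr : (n <= r)%N.
  by apply: n_min; apply/asboolP; split => //; exists (w - w0 *~ (k %/ n)%Z).
by move: rlt nr; lia.
Qed.

Lemma hom_extension : exists f : {additive A -> V}, {in H, f =1 phi}.
Proof.
(* [Zorn_bigcup] includes the empty chain, so the graph of phi is added to G instead of being
   required to lie in G. *)
pose P (G : set (A * V)) := functional_subgroup (G `|` additive_graph).
have P0 : P set0 by rewrite /P set0U; exact: additive_graph_functional.
have [F FP Ftot|G [PG Gmax]] := @Zorn_bigcup _ P.
  have common a b : (\bigcup_(X in F) X `|` additive_graph) a ->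
      (\bigcup_(X in F) X `|` additive_graph) b ->
      exists G0, [/\ P G0, G0 `<=` \bigcup_(X in F) X,
        (G0 `|` additive_graph) a & (G0 `|` additive_graph) b].
    move=> [[X FX Xa]|ga] [[Y FY Yb]|gb].
    - have [XY|YX] := Ftot _ _ FX FY.
        exists Y; split; [exact: FP|exact: bigcup_sup|left; exact: XY|by left].
      exists X; split; [exact: FP|exact: bigcup_sup|by left|left; exact: YX].
    - by exists X; split; [exact: FP|exact: bigcup_sup|left|right].
    - by exists Y; split; [exact: FP|exact: bigcup_sup|right|left].
    - by exists set0; split => //; right.
  split=> [a b Ua Ub|v Uv].
    have [G0 [[GB _] sG Ga Gb]] := common _ _ Ua Ub.
    by case: (GB _ _ Ga Gb) => [/sG|]; [left|right].
  by have [G0 [[_ G0v] _ /G0v]] := common _ _ Uv Uv.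
have [GB G0] := PG; set G' := G `|` additive_graph in GB G0.
have G'0 : G' (0, 0) by right; exact: additive_graph0.
have dom x : exists v, G' (x, v).
  have [u uP] := functional_extend x PG G'0.
  pose G2 : set (A * V) :=
    [set a | exists k b, G' b /\ a = (b.1 + x *~ k, b.2 + u *~ k)].
  have GG2 : G' `<=` G2.
    by move=> [b1 b2] Gb; exists 0, (b1, b2); split; rewrite //= !mulr0z !addr0.
  have PG2 : P G2.
    have -> : P G2 = functional_subgroup G2.
      by congr functional_subgroup; apply/setUidPl => a ga; apply: GG2; right.
    split=> [_ _ [k [a [Ga ->]]] [l [b [Gb ->]]]|v [k [b [Gb]]]].
      exists (k - l), (a.1 - b.1, a.2 - b.2); split; first exact: GB.
      by congr pair => /=; zmod.
    case=> b1 ->; have Gk : G' (x *~ k, - b.2).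
      have -> : x *~ k = - b.1.
        have -> : - b.1 = (b.1 + x *~ k) - b.1 by rewrite -b1 sub0r.
        by zmod.
      by have := GB _ _ G'0 Gb; rewrite /= !sub0r.
    by rewrite -(uP _ _ Gk) subrr.
  apply: contrapT => nx; apply: (Gmax G2) => //; split.
    by move=> a Ga; apply: GG2; left.
  move=> /(_ (x, u)) G2G; apply: nx; exists u; left; apply: G2G.
  by exists 1, (0, 0); split; rewrite //= !mulr1z !add0r.
have /choice[f fP] := dom.
have f_uniq x v : G' (x, v) -> v = f x.
  move=> Gv; have := GB _ _ Gv (fP x); rewrite /= subrr => /G0/eqP.
  by rewrite subr_eq0 => /eqP.
have fB x y : f (x - y) = f x - f y by apply/esym/f_uniq/(GB (_, _) (_, _)).
exists (mk_additive fB) => x xH; apply/esym/f_uniq; right.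
by split.
Qed.

End HomExtension.

(** The properties of the Pruefer group on which the proof relies. By the last one, an element of
    order at least p^(k+1) generates everything killed by p^(k+1). *)
Record quasicyclic (p : nat) (V : zmodType) : Prop := Quasicyclic {
  quasicyclic_divisible : divisible V;
  quasicyclic_torsion : forall v : V, exists k : nat, v *+ p ^ k = 0;
  quasicyclic_order_p : exists2 u : V, u != 0 & u *+ p = 0;
  quasicyclic_multiple : forall (w v : V) k,
    w *+ p ^ k != 0 -> v *+ p ^ k.+1 = 0 -> exists i : int, v = w *~ i }.

Lemma Bezout_pow (a : int) (p k : nat) : prime p -> ~~ (p%:Z %| a)%Z ->
  exists u v : int, u * a + v * (p ^ k)%N%:Z = 1.
Proof.
move=> p_pr npa; have : coprimez a (p ^ k)%N%:Z.
  by rewrite coprimez_sym coprimezE /= coprimeXl // prime_coprime.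
by case/coprimezP => -[u v] /= e; exists u, v.
Qed.

Lemma prufer_quasicyclic p : prime p -> quasicyclic p (prufer p).
Proof.
move=> p_pr; have p0 := prime_gt0 p_pr.
have pQ : (p%:R : rat) != 0 by rewrite pnatr_eq0 -lt0n.
have pXQ k : (p%:R : rat) ^+ k != 0 by rewrite expf_neq0.
have [pi [pi_surj pi0]] := quot_proj (subgroup_in Zrat (Zinv p)).
have inZ (m : int) (k : nat) : (m%:~R / p%:R ^+ k : rat) \in Zinv p.
  by apply/asboolP; exists m, k.
pose mk m k : subgroup_type (Zinv p) :=
  exist (fun q : rat => q \in subgroup_mem (Zinv p)) _ (inZ m k).
pose pr m k : prufer p := pi (mk m k).
have pr_surj v : exists m k, v = pr m k.
  have [[q qZ] <-] := pi_surj v; have /asboolP[m [k qE]] := qZ.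
  by exists m, k; congr (pi _); apply: val_inj.
have prB m n k : pr (m - n) k = pr m k - pr n k.
  rewrite /pr -raddfB; congr (pi _); apply: val_inj => /=.
  by rewrite rmorphB mulrBl.
have prz m k i : pr m k *~ i = pr (m * i) k.
  rewrite /pr -raddfMz; congr (pi _); apply: val_inj.
  by rewrite raddfMz /= rmorphM /= mulrAC mulrzr.
have prn m k i : pr m k *+ i = pr (m * i%:Z) k by rewrite -prz.
have prX m k j : pr (m * (p ^ j)%N%:Z) (k + j)%N = pr m k.
  congr (pi _); apply: val_inj => /=.
  rewrite rmorphM /= -natz rmorph_nat natrX exprD invfM mulrA mulrAC.
  by rewrite mulfK.
have pr0 m k : (pr m k == 0) = ((p ^ k)%N%:Z %| m)%Z.
  rewrite /pr pi0; apply/asboolP/dvdzP => /=.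
    move=> /asboolP[n e]; exists n; apply/(@intr_inj rat).
    rewrite rmorphM /= -(natz (p ^ k)) rmorph_nat natrX -e.
    by rewrite divfK.
  move=> [n ->]; apply/asboolP; exists n.
  by rewrite rmorphM /= -(natz (p ^ k)) rmorph_nat natrX mulfK.
have pr_eq m n k : ((p ^ k)%N%:Z %| m - n)%Z -> pr m k = pr n k.
  by rewrite -pr0 prB subr_eq0 => /eqP.
split.
(* With n = n' p^a, the factor p^a is absorbed by the denominator and n' is inverted modulo p^k. *)
- move=> v n n0; have [m [k ->]] := pr_surj v.
  have [n' copr nE] := pfactor_coprime p_pr n0.
  have [|u [w uw]] := @Bezout_pow n'%:Z p k p_pr; first by rewrite dvdzE /= -prime_coprime.
  set a := logn p n in nE.
  exists (pr (u * m) (k + a)); rewrite prn -(prX m k a).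
  apply: pr_eq; apply/dvdzP; exists (- w * m).
  rewrite nE expnD !PoszM; set P := (p ^ a)%N%:Z; set Q := (p ^ k)%N%:Z in uw *.
  have -> : m * P = m * P * (u * n'%:Z + w * Q) by rewrite uw mulr1.
  lia.
- move=> v; have [m [k ->]] := pr_surj v; exists k; rewrite prn; apply/eqP.
  by rewrite pr0 dvdz_mull.
- exists (pr 1 1); first by rewrite pr0 dvdzE /= expn1 dvdn1 neq_ltn prime_gt1 ?orbT.
  by rewrite prn; apply/eqP; rewrite pr0 expn1 mul1r.
- move=> w v k wk vk.
  (* In a representation w = a / p^l with l least, a is prime to p and l > k; so v has denominator
     p^l too, and a is inverted modulo p^l. *)
  have ex : exists l, `[< exists a, w = pr a l >].
    by have [a [l e]] := pr_surj w; exists l; apply/asboolP; exists a.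
  have [l /asboolP[a wE] l_min] := ex_minnP ex.
  have kl : (k < l)%N.
    rewrite ltnNge; apply/negP => lk; move: wk.
    by rewrite wE prn pr0 dvdz_mull // dvdzE /= dvdn_exp2l.
  have npa : ~~ (p%:Z %| a)%Z.
    apply/negP => /dvdzP[a' aE]; have := l_min l.-1; case: l kl wE {l_min} => // l _ wE.
    rewrite ltnn => /(_ _)/notF; apply; apply/asboolP; exists a'.
    by rewrite wE aE -(prX a' l 1%N) expn1 addn1.
  have [c vE] : exists c, v = pr c l.
    have [b [l' bE]] := pr_surj v.
    have : v *+ p ^ l = 0 by rewrite -(subnK kl) expnD mulnC mulrnA vk mul0rn.
    rewrite bE prn => /eqP; rewrite pr0 => /dvdzP[c cE]; exists c.
    by rewrite -(prX b l' l) cE addnC prX.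
  have [u [t ut]] := Bezout_pow l p_pr npa.
  exists (u * c); rewrite wE vE prz; apply: pr_eq; apply/dvdzP; exists (t * c).
  have -> : c - a * (u * c) = c * (u * a + t * (p ^ l)%N%:Z) - a * (u * c).
    by rewrite ut mulr1.
  lia.
Qed.

(** * Finiteness of socles *)

Lemma prime_dvdn_fact p n : prime p -> (p %| n`!)%N -> (p <= n)%N.
Proof.
move=> p_pr; elim: n => [|n IH]; first by rewrite fact0 dvdn1 => /eqP p1; rewrite p1 in p_pr.
rewrite factS Euclid_dvdM // => /orP[/dvdn_leq-> //|/IH/leqW//].
Qed.

(** Modulo H, x generates a group of order p. It embeds in V, and the embedding extends because V is
    divisible. *)
Lemma quasicyclic_hom (A V : zmodType) (p : nat) (H : subgroups A) (x : A) :
  prime p -> quasicyclic p V -> x \notin H -> x *+ p \in H ->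
  exists f : {additive A -> V},
    [/\ forall y, y \in H -> f y = 0, f x != 0 & f x *+ p = 0].
Proof.
move=> p_pr qV xH xp; have [u u0 up] := quasicyclic_order_p qV.
have uniq_coef k l : x *~ (k - l) \in H -> u *~ k = u *~ l.
  move=> xkl; have : (p %| `|(k - l)%R|)%N.
    apply: contraT; rewrite -prime_coprime // => cop.
    by case/negP: xH; apply: rpred_coprime cop xp _; rewrite rpred_absz.
  move=> pkl; have /dvdzP[c kl] : (p%:Z %| k - l)%Z by rewrite dvdzE.
  have -> : k = l + c * p%:Z by rewrite -kl; lia.
  have -> : u *~ (l + c * p%:Z) = u *~ l + (u *+ p) *~ c by zmod.
  by rewrite up mul0rz addr0.
pose coef y := xget 0 [set k : int | y - x *~ k \in H].
have coefP y k : y - x *~ k \in H -> u *~ coef y = u *~ k.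
  move=> yk; have yc : y - x *~ coef y \in H.
    by apply: (@xgetPex _ 0 [set k : int | y - x *~ k \in H]); exists k.
  apply: uniq_coef; have -> : x *~ (coef y - k) = (y - x *~ k) - (y - x *~ coef y) by zmod.
  exact: rpredB.
have [|f fE] := @hom_extension A V (adjoin H x) (fun y => u *~ coef y) (quasicyclic_divisible qV).
  move=> y z /mem_adjoin[k yk] /mem_adjoin[l zl].
  rewrite (coefP _ _ yk) (coefP _ _ zl) -mulrzBr; apply: coefP.
  have -> : y - z - x *~ (k - l) = (y - x *~ k) - (z - x *~ l) by zmod.
  exact: rpredB.
have fx : f x = u.
  rewrite (fE _ (adjoin_self _ _)) (coefP _ 1) ?mulr1z //.
  by rewrite subrr rpred0.
exists f; rewrite fx; split => // y yH.
by rewrite (fE _ (sub_adjoin x yH)) (coefP _ 0) ?mulr0z // subr0.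
Qed.

Section FiniteCosets.
Variable A : zmodType.
Implicit Types (H K Z : subgroups A) (x y z : A).

(** The elements satisfying P meet finitely many cosets of H; the representatives need not satisfy
    P. *)
Definition fin_cosets H (P : A -> Prop) : Prop :=
  exists s : seq A, forall x, P x -> exists2 y, y \in s & x - y \in H.

(** The socle of A/H is finite: each p-socle is, and only finitely many primes contribute. *)
Definition finite_socle H : Prop :=
  (forall p, prime p -> fin_cosets H (fun x => x *+ p \in H)) /\
  exists N, forall p, prime p -> (N < p)%N -> forall x, x *+ p \in H -> x \in H.

Fact kernel_closed (V : zmodType) (f : {additive A -> V}) :
  zmod_closed (fun x => `[< f x = 0 >]).
Proof.
split=> [|x y /asboolP fx /asboolP fy]; apply/asboolP; first exact: raddf0.
by rewrite raddfB fx fy subrr.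
Qed.

Definition kernel (V : zmodType) (f : {additive A -> V}) : subgroups A :=
  Subgroup (kernel_closed f).

Lemma mem_kernel (V : zmodType) (f : {additive A -> V}) x :
  x \in kernel f <-> f x = 0.
Proof. by split=> [/asboolP|fx]; [|apply/asboolP]. Qed.

Fact nroot_closed H n : zmod_closed (fun x => `[< x *+ n \in H >]).
Proof.
split=> [|x y /asboolP xn /asboolP yn]; apply/asboolP; first by rewrite mul0rn rpred0.
by rewrite mulrnBl rpredB.
Qed.

Definition nroot H n : subgroups A := Subgroup (nroot_closed H n).

Lemma mem_nroot H n x : (x \in nroot H n) = (x *+ n \in H).
Proof. exact: asboolb. Qed.

(* In a minimal infinite subgroup L of p-torsion mod K, the kernel of a nonzero map
   to a quasicyclic group has finite index, so it is again infinite. *)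
Lemma dcc_fin_cosets Z K p : dcc Z -> {subset Z <= K} -> prime p ->
  fin_cosets K (fun x => x *+ p \in K).
Proof.
move=> dccZ ZK p_pr; apply: contrapT => ninf.
have [||L [KL Lp nL] Lmin] := @dcc_min _ Z (fun L => [/\ {subset K <= L},
   forall x, x \in L -> x *+ p \in K & ~ fin_cosets K (fun x => x \in L)]) dccZ.
  - by move=> L [KL _ _] x /ZK/KL.
  - exists (nroot K p); split => [x xK|x|].
    + by rewrite mem_nroot rpredMn.
    + by rewrite mem_nroot.
    + move=> [s sP]; apply: ninf; exists s => x xp; apply: sP.
      by rewrite mem_nroot.
have [x xL xK] : exists2 x, x \in L & x \notin K.
  apply: contrapT => nx; apply: nL; exists [:: 0] => x xL; exists 0; rewrite ?mem_head //.
  by rewrite subr0; apply: contraT => xK; case: nx; exists x.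
have [f [fK fx fxp]] := quasicyclic_hom p_pr (prufer_quasicyclic p_pr) xK (Lp _ xL).
suff : x \in cap L (kernel f).
  by rewrite mem_cap => /andP[_ /mem_kernel/eqP]; rewrite (negPf fx).
rewrite (Lmin (cap L (kernel f))) // => [|y]; last by rewrite mem_cap => /andP[].
split=> [y yK|y|[s sP]].
- by rewrite mem_cap KL //; apply/mem_kernel/fK.
- by rewrite mem_cap => /andP[/Lp].
(* f sends L into the group of order p generated by [f x], so the x *+ j with j < p represent L
   modulo the kernel. *)
apply: nL; exists [seq y + x *+ j | y <- s, j <- iota 0 p] => z zL.
have fzp : f z *+ p = 0 by rewrite -raddfMn fK ?Lp.
have [|i fzE] := quasicyclic_multiple (prufer_quasicyclic p_pr)
  (w := f x) (v := f z) (k := 0) _ fzp.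
  by rewrite mulr1n.
have p0 : p%:Z != 0 by rewrite eqz_nat -lt0n prime_gt0.
have := modz_ge0 i p0; have := ltz_mod i p0; have := divz_eq i p.
case: (i %% p)%Z => // j iE jp _.
have [|y ys zy] := sP (z - x *+ j).
  rewrite mem_cap rpredB ?rpredMn //=; apply/mem_kernel.
  rewrite raddfB raddfMn fzE iE.
  have -> : f x *~ ((i %/ p)%Z * p + j) - f x *+ j = f x *+ p *~ (i %/ p)%Z by zmod.
  by rewrite fxp mul0rz.
exists (y + x *+ j); last by have -> : z - (y + x *+ j) = z - x *+ j - y by zmod.
apply/allpairsP; exists (y, j); split => //=.
by rewrite mem_iota add0n; lia.
Qed.

(** Elements whose order modulo K is prime to i! form a decreasing chain, stationary from some N on.
    If x has order p > N modulo K, it belongs to the N-th term, hence to the p-th, so some multiple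
    of x by a number prime to p lies in K. *)
Lemma dcc_no_large_torsion Z K : dcc Z -> {subset Z <= K} ->
  exists N, forall p, prime p -> (N < p)%N -> forall x, x *+ p \in K -> x \in K.
Proof.
move=> dccZ ZK.
have cl i : zmod_closed (fun x => `[< exists n, coprime n i`! /\ x *+ n \in K >]).
  split=> [|x y /asboolP[m [mc xm]] /asboolP[n [nc yn]]]; apply/asboolP.
    by exists 1%N; rewrite coprime1n mul0rn rpred0.
  exists (m * n)%N; split; first by rewrite coprimeMl mc.
  have -> : (x - y) *+ (m * n) = x *+ m *+ n - y *+ n *+ m by zmod.
  by rewrite rpredB // rpredMn.
have [i x /ZK xK|i x|N NP] := dccZ (fun i => Subgroup (cl i)).
- by apply/asboolP; exists 1%N; rewrite coprime1n mulr1n.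
- move=> /asboolP[n [nc xn]]; apply/asboolP; exists n; split => //.
  by apply: coprime_dvdr nc; rewrite factS dvdn_mull.
exists N => p p_pr Np x xp.
have : x \in Subgroup (cl N).
  apply/asboolP; exists p; split => //; rewrite prime_coprime //.
  by apply: contraL Np; rewrite -leqNgt; apply: prime_dvdn_fact.
rewrite -(NP p (ltnW Np)) => /asboolP[n [nc xn]].
apply: rpred_coprime xp xn; rewrite coprime_sym; apply: coprime_dvdr nc.
by rewrite dvdn_fact // prime_gt0 //=.
Qed.

(** Passing down from K + Zz to K costs finitely many multiples of z. Here n is a positive number
    with nz in K if there is one; otherwise n = 1, and iz in K forces i = 0. *)
Lemma finite_socle_adjoin K z : finite_socle (adjoin K z) -> finite_socle K.
Proof.
move=> [finK' [N NP]].
have [n n0 nP] : exists2 n, (0 < n)%N & forall i, z *~ i \in K -> (z *+ n \in K) \/ i = 0.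
  have [[n [n0 zn]]|nn] := pselect (exists n, (0 < n)%N /\ z *+ n \in K).
    by exists n => // i _; left.
  exists 1%N => // i zi; right; apply: contrapT => /eqP i0; apply: nn.
  by exists `|i|%N; rewrite absz_gt0 i0 rpred_absz.
split=> [p p_pr|].
- have [R RP] := finK' p p_pr.
  (* A representative y may fail to satisfy the socle condition for K; [c y] is an element of the
     same coset that does, whenever there is one. *)
  have /choice[c cP] : forall y, exists x, forall x', x' *+ p \in K ->
      x' - y \in adjoin K z -> x *+ p \in K /\ x - y \in adjoin K z.
    move=> y; have [[x [xp xy]]|nx] :=
      pselect (exists x, x *+ p \in K /\ x - y \in adjoin K z); first by exists x.
    by exists 0 => x' xp xy; case: nx; exists x'.
  exists [seq c y + z *+ i | y <- R, i <- iota 0 n] => x xp.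
  have [y yR xy] := RP x (sub_adjoin z xp).
  have [cyp cy] := cP y x xp xy.
  have : x - c y \in adjoin K z.
    have -> : x - c y = (x - y) - (c y - y) by zmod.
    exact: rpredB.
  move=> /mem_adjoin[i xi].
  have zip : z *~ (i * p) \in K.
    have -> : z *~ (i * p) = x *+ p - c y *+ p - (x - c y - z *~ i) *+ p by zmod.
    by rewrite !rpredB // rpredMn.
  suff [j jn zj] : exists2 j : nat, (j < n)%N & z *~ i - z *+ j \in K.
    exists (c y + z *+ j); last first.
      have -> : x - (c y + z *+ j) = (x - c y - z *~ i) + (z *~ i - z *+ j) by zmod.
      exact: rpredD.
    by apply/allpairsP; exists (y, j); split => //=; rewrite mem_iota.
  case: (nP _ zip) => [zn|/eqP]; last first.
    rewrite mulf_eq0 eqz_nat -[(p == 0)%N]negbK -lt0n prime_gt0 //= orbF => /eqP ->.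
    by exists 0%N => //; rewrite mulr0z mulr0n subrr rpred0.
  have n_neq0 : n%:Z != 0 by rewrite eqz_nat -lt0n.
  have := modz_ge0 i n_neq0; have := ltz_mod i n_neq0; have := divz_eq i n.
  case: (i %% n)%Z => // j iE jn _; exists j; first by lia.
  have -> : z *~ i - z *+ j = z *+ n *~ (i %/ n)%Z.
    by move: iE; set q := (i %/ n)%Z => ->; zmod.
  exact: rpredMz.
- exists (maxn N n) => p p_pr; rewrite gtn_max => /andP[Np np] x xp.
  have /mem_adjoin[i xi] := NP p p_pr Np x (sub_adjoin z xp).
  have zip : z *~ (i * p) \in K.
    have -> : z *~ (i * p) = x *+ p - (x - z *~ i) *+ p by zmod.
    by rewrite !rpredB // rpredMn.
  suff zi : z *~ i \in K.
    have -> : x = (x - z *~ i) + z *~ i by zmod.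
    exact: rpredD.
  case: (nP _ zip) => [zn|/eqP]; last first.
    rewrite mulf_eq0 eqz_nat -[(p == 0)%N]negbK -lt0n prime_gt0 //= orbF => /eqP ->.
    by rewrite mulr0z rpred0.
  apply: (@rpred_coprime _ _ _ p n).
  + by rewrite prime_coprime // gtnNdvd.
  + by have -> : z *~ i *+ p = z *~ (i * p) by zmod.
  + have -> : z *~ i *+ n = z *+ n *~ i by zmod.
    exact: rpredMz.
Qed.

(** K need not contain Z. The chain condition treats K + Z, and the generators of Z are then removed
    one at a time. *)
Lemma dcc_finite_socle Z s K : dcc Z -> Z =i span s -> finite_socle K.
Proof.
move=> dccZ Zs; suff : finite_socle (adjoins K s).
  by elim: s {Zs} => //= z s IH /finite_socle_adjoin.
have ZK : {subset Z <= adjoins K s}.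
  by move=> x; rewrite Zs; apply: span_sub; apply: mem_adjoins.
split; last exact: dcc_no_large_torsion dccZ ZK.
by move=> p p_pr; apply: dcc_fin_cosets dccZ ZK p_pr.
Qed.

Section FiniteSocle.
Hypothesis finA : forall H, finite_socle H.

Lemma fin_cosets_nroot H n : (0 < n)%N -> fin_cosets H (fun x => x *+ n \in H).
Proof.
elim/ltn_ind: n H => n IH H n0.
have [n1|n1] := leqP n 1.
  exists [:: 0] => x; have -> : n = 1%N by lia.
  by rewrite mulr1n => xH; exists 0; rewrite ?mem_head // subr0.
have p_pr := pdiv_prime n1; have pn := pdiv_dvd n; set p := pdiv n in p_pr pn.
have q0 : (0 < n %/ p)%N by rewrite divn_gt0 ?prime_gt0 // dvdn_leq.
have [|s sP] := IH (n %/ p)%N _ (nroot H p) q0; first by rewrite ltn_Pdiv ?prime_gt1.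
have [t tP] := (finA H).1 p p_pr.
exists [seq y + z | y <- s, z <- t] => x xn.
have [|y ys] := sP x; first by rewrite mem_nroot -mulrnA divnK.
rewrite mem_nroot => /tP[z zt xyz].
by exists (y + z); [apply/allpairsP; exists (y, z)|rewrite opprD addrA].
Qed.

Lemma socle_reps H : exists F : seq A, forall p x, prime p -> x *+ p \in H ->
  exists2 y, y \in F & x - y \in H.
Proof.
have [finH [N NP]] := finA H.
have /choice[s sP] : forall p, exists s : seq A, prime p -> forall x, x *+ p \in H ->
    exists2 y, y \in s & x - y \in H.
  move=> p; have [/finH[s sP]|np] := boolP (prime p); first by exists s.
  by exists [::].
(* The entry 0 serves the primes above N, for which x already lies in H. *)
exists (0 :: flatten [seq s p | p <- iota 0 N.+1]) => p x p_pr xp.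
have [pN|Np] := leqP p N; last first.
  by exists 0; rewrite ?mem_head // subr0 (NP p).
have [y ys xy] := sP p p_pr x xp; exists y => //; rewrite inE; apply/orP; right.
by apply/flattenP; exists (s p) => //; apply: map_f; rewrite mem_iota.
Qed.

Definition unbounded (p : nat) H : Prop :=
  forall k, exists w, w *+ p ^ k.+1 \in H /\ w *+ p ^ k \notin H.

(** Pigeonhole in the finite p-socle of A/H: the elements w *+ p ^ k of order p obtained for all k
    fall in finitely many classes, so one class is reached for arbitrarily large k. It is the bottom
    of a Pruefer group in A/H. *)
Lemma unboundedP p H : prime p -> unbounded p H ->
  exists x, [/\ x \notin H, x *+ p \in H & forall k, exists y, y *+ p ^ k - x \in H].
Proof.
move=> p_pr unb; have [s sP] := (finA H).1 p p_pr.
have [x xs xP] : exists2 x, x \in s & forall k, exists2 k', (k <= k')%N &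
    exists w, [/\ w *+ p ^ k'.+1 \in H, w *+ p ^ k' \notin H & w *+ p ^ k' - x \in H].
  apply: contrapT => nx.
  have [M MP] : exists M, forall x, x \in s -> forall k' w, (M <= k')%N ->
      w *+ p ^ k'.+1 \in H -> w *+ p ^ k' \notin H -> w *+ p ^ k' - x \notin H.
    have : {subset s <= s} by []; elim: {1 3}s => [|x t IH] ts; first by exists 0%N.
    have [|M MP] := IH; first by move=> y yt; apply: ts; rewrite inE yt orbT.
    have [k kP] : exists k, forall k' w, (k <= k')%N ->
      w *+ p ^ k'.+1 \in H -> w *+ p ^ k' \notin H -> w *+ p ^ k' - x \notin H.
      apply: contrapT => nk; apply: nx; exists x; first exact/ts/mem_head.
      move=> k; apply: contrapT => nk'; apply: nk; exists k => k' w kk' w1 w2.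
      by apply/negP => wx; apply: nk'; exists k' => //; exists w.
    exists (maxn M k) => y; rewrite inE => /predU1P[->|yt] k' w; rewrite geq_max => /andP[Mk kk].
      exact: kP.
    exact: MP.
  have [w [w1 w2]] := unb M.
  have [|y ys wy] := sP (w *+ p ^ M); first by rewrite -mulrnA -expnSr.
  by have := MP y ys M w (leqnn _) w1 w2; rewrite wy.
have xE k' w : w *+ p ^ k' - x \in H -> x = w *+ p ^ k' - (w *+ p ^ k' - x) by move=> _; zmod.
exists x; split.
- have [k' _ [w [w1 w2 wx]]] := xP 0%N; apply: contra w2 => xH.
  have -> : w *+ p ^ k' = (w *+ p ^ k' - x) + x by zmod.
  exact: rpredD.
- have [k' _ [w [w1 w2 wx]]] := xP 0%N.
  have -> : x *+ p = w *+ p ^ k'.+1 - (w *+ p ^ k' - x) *+ p by rewrite expnS; zmod.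
  by rewrite rpredB // rpredMn.
- move=> k; have [k' kk [w [_ _ wx]]] := xP k; exists (w *+ p ^ (k' - k)).
  by rewrite -mulrnA -expnD subnK.
Qed.

End FiniteSocle.

(** If no element has order p^(k+1) modulo H, none has a larger p-power order, since a multiple of
    it would have that one. *)
Lemma boundedP p H : ~ unbounded p H ->
  exists k, forall w j, w *+ p ^ j \in H -> w *+ p ^ k \in H.
Proof.
move=> /existsNP[k /forallNP kP]; exists k => w j.
have step i v : (k <= i)%N -> v *+ p ^ i \in H -> v *+ p ^ k \in H.
  elim: i v => [|i IH] v; first by rewrite leqn0 => /eqP ->.
  rewrite leq_eqVlt => /predU1P[->//|ki] vi; apply: contraT => vk.
  have := kP (v *+ p ^ (i - k)); rewrite -!mulrnA -!expnD addnS subnK //.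
  have [vi' _|vi' []//] := boolP (v *+ p ^ i \in H).
  by rewrite (IH v) in vk.
have [jk|/ltnW kj] := leqP j k; last exact: step.
by move=> wj; rewrite -(subnK jk) expnD mulnC mulrnA rpredMn.
Qed.

End FiniteCosets.

(** * Finitely generated subgroups with divisible torsion quotient *)

Section DivisibleCore.
Variable A : zmodType.
Implicit Types (H K Z : subgroups A) (x y z : A) (s t : seq A).

Lemma span_noetherian s H : {subset H <= span s} -> exists t, H =i span t.
Proof.
elim: s H => [|z s IH] H Hs.
  exists [::] => x; apply/idP/idP => [/Hs//|/asboolP ->]; exact: rpred0.
have [|t tP] := IH (cap H (span s)).
  by move=> x; rewrite mem_cap => /andP[].
have tH : {subset span t <= H} by move=> x; rewrite -tP mem_cap => /andP[].
have [[n0 [n0_gt0 [h0 h0H h0P]]]|nn] := pselect (exists n, (0 < n)%N /\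
    exists2 h, h \in H & h - z *+ n \in span s); last first.
  exists t => x; rewrite -tP mem_cap; apply/idP/andP => [xH|[]//]; split => //.
  have /mem_adjoin[k xk] := Hs x xH.
  suff k0 : k = 0 by rewrite k0 mulr0z subr0 in xk.
  case: k xk => [[|k]|k] xk //; case: nn; exists k.+1; split => //.
    by exists x.
  exists (- x); rewrite ?rpredN // -rpredN.
  by have -> : - (- x - z *+ k.+1) = x - z *~ Negz k by rewrite NegzE; zmod.
have ex : exists n, `[< (0 < n)%N /\ exists2 h, h \in H & h - z *+ n \in span s >].
  by exists n0; apply/asboolP; split => //; exists h0.
(* The z-coefficients of elements of H are the multiples of n, and h realises n. *)
have [n /asboolP[n_gt0 [h hH hn]] n_min] := ex_minnP ex.
exists (h :: t) => x; apply/idP/idP; last first.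
  by apply: adjoin_sub.
move=> xH; apply/mem_adjoin.
have /mem_adjoin[k xk] := Hs x xH.
have n_neq0 : n%:Z != 0 by rewrite eqz_nat -lt0n.
exists (k %/ n)%Z; rewrite -tP mem_cap rpredB ?rpredMz //=.
have := modz_ge0 k n_neq0; have := ltz_mod k n_neq0; have := divz_eq k n.
set q := (k %/ n)%Z; case: (k %% n)%Z => // r kE rn _.
have rem : x - h *~ q - z *+ r \in span s.
  have -> : x - h *~ q - z *+ r = (x - z *~ k) - (h - z *+ n) *~ q by rewrite kE; zmod.
  by rewrite rpredB // rpredMz.
have [r0|r0] := posnP r; first by rewrite r0 mulr0n subr0 in rem.
have nr : (n <= r)%N.
  apply: n_min; apply/asboolP; split => //; exists (x - h *~ q) => //.
  by rewrite rpredB // rpredMz.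
by move: rn nr; lia.
Qed.

Lemma span_countable s : countable [set x | x \in span s].
Proof.
elim: s => [|z s IH].
  apply: sub_countable (countable1 0); apply: subset_card_le => x /asboolP ->.
  by [].
apply: (@sub_countable _ _ _ (\bigcup_(k in [set: int])
    ((fun x => x + z *~ k) @` [set x | x \in span s]))).
  apply: subset_card_le => x /mem_adjoin[k xk]; exists k => //.
  by exists (x - z *~ k) => //; zmod.
apply: bigcup_countable => // k _; apply: sub_countable IH; exact: card_image_le.
Qed.

Section Core.
Variables (Z : subgroups A) (s : seq A).
Hypotheses (dccZ : dcc Z) (Zs : Z =i span s).

Let finA H : finite_socle H := dcc_finite_socle H dccZ Zs.

Lemma minimax_countable : countable [set: A].
Proof.
have /choice[R RP] : forall m, exists R : seq A, (0 < m)%N ->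
    forall x, x *+ m \in Z -> exists2 y, y \in R & x - y \in Z.
  move=> m; have [->|m0] := posnP m; first by exists [::].
  by have [R RP] := fin_cosets_nroot finA Z m0; exists R.
apply: (@sub_countable _ _ _ (\bigcup_(m in [set: nat]) \bigcup_(y in [set` R m])
    ((fun z => y + z) @` [set z | z \in Z]))).
  apply: subset_card_le => x _; have [m m0 xm] := dcc_torsion x dccZ.
  have [y yR xy] := RP m m0 x xm; exists m => //; exists y => //.
  by exists (x - y) => //; zmod.
apply: bigcup_countable => // m _; apply: bigcup_countable => [|y _].
  exact/finite_set_countable/finite_seq.
apply: sub_countable (card_image_le _ _) _.
have -> : [set z | z \in Z] = [set z | z \in span s].
  by apply/seteqP; split => z /=; rewrite Zs.
exact: span_countable.
Qed.

(** The chain i! H + Z is stationary from some N on. Modulo M = N! H + (H meet Z), H has exponent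
    dividing N!, hence is finite. Generators of H meet Z together with representatives of H/M span
    H': modulo H' every element is in N! H, hence in (N+m)! H, and is divisible by m. *)
Lemma divisible_core H : exists t,
  [/\ {subset span t <= H}, {subset cap H Z <= span t},
      forall x, x \in H -> exists2 n, (0 < n)%N & x *+ n \in span t &
      forall m x, (0 < m)%N -> x \in H -> exists2 y, y \in H & x - y *+ m \in span t].
Proof.
have [|t0 t0P] := @span_noetherian s (cap H Z).
  by move=> x; rewrite mem_cap Zs => /andP[].
have t0H : {subset span t0 <= H} by move=> x; rewrite -t0P mem_cap => /andP[].
pose mul i : subgroups A := Subgroup (mulset_closed H i).
have mulP i x : reflect (exists2 y, y \in H & x = y *+ i) (x \in mul i).
  exact: (@asboolP (exists2 y, y \in H & x = y *+ i)).
pose add K L : subgroups A := Subgroup (sum_closed K L).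
have addP K (L : subgroups A) x : reflect (exists2 y, y \in K & x - y \in L) (x \in add K L).
  exact: (@asboolP (exists2 y, y \in K & x - y \in L)).
have [i x xZ|i x|N NP] := dccZ (u := fun i => add (mul i`!) Z).
- by apply/addP; exists 0; rewrite ?subr0 ?rpred0.
- move=> /addP[_ /mulP[h hH ->] xh]; apply/addP.
  exists (h *+ (i.+1)`!) => //; apply/mulP; exists (h *+ i.+1); first exact: rpredMn.
  by rewrite factS mulrnA.
pose M := add (mul N`!) (span t0).
have [R RP] := fin_cosets_nroot finA M (fact_gt0 N).
have MH : {subset M <= H}.
  move=> x /addP[_ /mulP[h hH ->] /t0H xh].
  have -> : x = (x - h *+ N`!) + h *+ N`! by zmod.
  by rewrite rpredD // rpredMn.
pose t := t0 ++ [seq y <- R | y \in H].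
have tH : {subset span t <= H}.
  apply: span_sub => y; rewrite mem_cat mem_filter => /orP[yt|/andP[]//].
  exact/t0H/mem_span.
have t0t : {subset span t0 <= span t}.
  by apply: span_sub => y yt; apply: mem_span; rewrite mem_cat yt.
exists t; split => //.
- by move=> x; rewrite t0P => /t0t.
- move=> x xH; have [n n0 xn] := dcc_torsion x dccZ; exists n => //.
  by apply: t0t; rewrite -t0P mem_cap xn rpredMn.
- move=> m x m0 xH.
  have [|y yR xyM] := RP x.
    by apply/addP; exists (x *+ N`!); rewrite ?subrr ?rpred0 //; apply/mulP; exists x.
  have yH : y \in H.
    have -> : y = x - (x - y) by zmod.
    by rewrite rpredB // MH.
  have yt : y \in span t by apply: mem_span; rewrite mem_cat mem_filter yH yR orbT.
  have /addP[_ /mulP[h hH ->] xyh] := xyM.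
  have : h *+ N`! \in add (mul N`!) Z.
    by apply/addP; exists (h *+ N`!); rewrite ?subrr ?rpred0 //; apply/mulP; exists h.
  rewrite -(NP (N + m)%N) ?leq_addr // => /addP[_ /mulP[h' h'H ->] hh'].
  have /dvdnP[c cE] : (m %| (N + m)`!)%N by rewrite dvdn_fact // m0 leq_addl.
  exists (h' *+ c); first exact: rpredMn.
  have -> : x - h' *+ c *+ m = (x - y - h *+ N`!) + (h *+ N`! - h' *+ (N + m)`!) + y.
    by rewrite cE; zmod.
  apply: rpredD => //; apply: rpredD; first exact: t0t.
  by apply: t0t; rewrite -t0P mem_cap hh' rpredB // rpredMn.
Qed.

End Core.

Fact full_closed : zmod_closed (fun x : A => `[< True >]).
Proof. by split=> [|x y _ _]; apply/asboolP. Qed.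

Definition full : subgroups A := Subgroup full_closed.

Lemma mem_full x : x \in full. Proof. exact/asboolP. Qed.

Lemma minimax_divisible_quotient : minimax A -> exists t, dcc (span t) /\
  forall m x, (0 < m)%N -> exists y, x - y *+ m \in span t.
Proof.
move=> [Z [/finitely_generatedE[s Zs] /artinian_dcc dccZ]].
have [t [_ Zt _ divt]] := divisible_core dccZ Zs full.
exists t; split; first by apply: dcc_sub dccZ => x xZ; apply: Zt; rewrite mem_cap mem_full.
by move=> m x m0; have [y _ xy] := divt m x m0 (mem_full x); exists y.
Qed.

End DivisibleCore.

(** * Rank *)

(** Membership in the isolator of H: x is torsion modulo H. *)
Definition isolated (A : zmodType) (H : subgroups A) (x : A) : Prop :=
  exists2 n, (0 < n)%N & x *+ n \in H.

Definition comb (A : zmodType) r (e : 'I_r -> A) (k : 'I_r -> int) : A :=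
  \sum_(i < r) e i *~ k i.

Lemma comb_Mz (A : zmodType) r (e : 'I_r -> A) k (m : int) :
  comb e k *~ m = comb e (fun i => k i * m).
Proof. by rewrite /comb mulrz_suml; apply: eq_bigr => i _; rewrite mulrzA. Qed.

Lemma combB (A : zmodType) r (e : 'I_r -> A) k l :
  comb e k - comb e l = comb e (fun i => k i - l i).
Proof. by rewrite /comb -sumrB; apply: eq_bigr => i _; rewrite mulrzBr. Qed.

(** A maximal independent family; it becomes a basis of A (x) Q. *)
Definition rational_basis (A : zmodType) r (e : 'I_r -> A) : Prop :=
  (forall k, comb e k = 0 -> forall i, k i = 0) /\
  forall y, exists2 n, (0 < n)%N & exists k, y *+ n = comb e k.

Section RationalCoordinates.
Variable A : zmodType.

Lemma independent_generators (t : seq A) : exists r (e : 'I_r -> A),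
  (forall k, comb e k = 0 -> forall i, k i = 0) /\
  forall y, y \in span t -> exists2 n, (0 < n)%N & exists k, y *+ n = comb e k.
Proof.
elim: t => [|z t [r [e [ind gen]]]].
  exists 0%N, (fun=> 0); split=> [k _ []//|y /asboolP ->]; exists 1%N => //.
  by exists (fun=> 0); rewrite /comb big_ord0 mul0rn.
have [[m [m0 [l zl]]]|nz] := pselect (exists m, (0 < m)%N /\ exists l, z *+ m = comb e l).
  exists r, e; split => // y /mem_adjoin[j /gen[n n0 [k yk]]].
  exists (n * m)%N; first by rewrite muln_gt0 n0.
  exists (fun i => k i * m%:Z - l i * (- j * n%:Z)); rewrite -combB -!comb_Mz -yk -zl.
  zmod.
pose e' (i : 'I_r.+1) := oapp e z (unlift ord0 i).
have e'E k : comb e' k = z *~ k ord0 + comb e (fun i => k (lift ord0 i)).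
  rewrite /comb big_ord_recl /e' unlift_none; congr (_ + _).
  by apply: eq_bigr => i _; rewrite liftK.
exists r.+1, e'; split=> [k|y /mem_adjoin[j /gen[n n0 [k yk]]]].
  rewrite e'E => e0.
  have k0 : k ord0 = 0.
    apply: contrapT => /eqP k0; apply: nz.
    exists `|k ord0|%N; split; first by rewrite absz_gt0.
    exists (fun i => k (lift ord0 i) * (- Num.sg (k ord0))); rewrite -comb_Mz.
    have -> : comb e (fun i => k (lift ord0 i)) = - (z *~ k ord0).
      by apply/eqP; rewrite -addr_eq0 addrC e0.
    case: (k ord0) k0 => [[//|i]|i] _.
      by rewrite gtr0_sg //=; zmod.
    by rewrite ltr0_sg //= NegzE; zmod.
  move: e0; rewrite k0 mulr0z add0r => /ind ki i.
  by case: (unliftP ord0 i) => [j ->|-> //]; exact: ki.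
exists n => //; exists (fun i => oapp k (j * n%:Z) (unlift ord0 i)).
rewrite e'E unlift_none /=.
have -> : comb e (fun i => oapp k (j * n%:Z) (unlift ord0 (lift ord0 i))) = comb e k.
  by apply: eq_bigr => i _; rewrite liftK.
by rewrite -yk; zmod.
Qed.

Lemma rational_coordinates r (e : 'I_r -> A) : rational_basis e ->
  exists c : {additive A -> 'rV[rat]_r},
    (forall i, c (e i) = delta_mx 0 i) /\ forall x, c x = 0 -> exists2 n, (0 < n)%N & x *+ n = 0.
Proof.
move=> [ind gen].
have /choice[d dP] : forall y, exists nk : nat * ('I_r -> int),
    (0 < nk.1)%N /\ y *+ nk.1 = comb e nk.2.
  by move=> y; have [n n0 [k yk]] := gen y; exists (n, k).
pose c y : 'rV[rat]_r := \row_i (((d y).2 i)%:~R / ((d y).1)%:R).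
have nat0 (n : nat) : (0 < n)%N -> (n%:R : rat) != 0 by rewrite pnatr_eq0 lt0n.
have cE y n k : (0 < n)%N -> y *+ n = comb e k -> c y = \row_i ((k i)%:~R / n%:R).
  move=> n0 yk; apply/rowP => i; rewrite !mxE; have [m0 yl] := dP y.
  set m := (d y).1 in m0 yl *; set l := (d y).2 in yl *.
  have /ind/(_ i) : comb e (fun i => k i * m%:Z - l i * n%:Z) = 0.
    by rewrite -combB -!comb_Mz -yk -yl; zmod.
  move/eqP; rewrite subr_eq0 => /eqP/(congr1 (fun z : int => z%:~R : rat)).
  rewrite !rmorphM /= -!pmulrn => kl.
  by apply/eqP; rewrite eqr_div ?nat0 // kl.
have cB y z : c (y - z) = c y - c z.
  have [m0 yk] := dP y; have [n0 zl] := dP z.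
  rewrite (@cE (y - z) ((d y).1 * (d z).1)%N
    (fun i => (d y).2 i * (d z).1%:Z - (d z).2 i * (d y).1%:Z)) ?muln_gt0 ?m0 //.
    apply/rowP => i; rewrite !mxE -[in RHS]mulNr addf_div ?nat0 // natrM.
    by rewrite rmorphB !rmorphM /= -!pmulrn mulNr.
  by rewrite -combB -!comb_Mz -yk -zl; zmod.
exists (mk_additive cB); split=> [i|x cx].
  rewrite /= (@cE _ 1%N (fun j => if j == i then 1 else 0)) //.
    by apply/rowP => j; rewrite !mxE eqxx divr1 /=; case: eqP.
  rewrite /comb (bigD1 i) //= eqxx mulr1n mulr1z big1 ?addr0 // => j /negPf ->.
  by rewrite mulr0z.
have [n0 xk] := dP x; exists (d x).1 => //; rewrite xk /comb big1 // => i _.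
have /rowP/(_ i) : c x = 0 by [].
rewrite !mxE => /eqP; rewrite mulf_eq0 invr_eq0 (negPf (nat0 _ n0)) orbF intr_eq0.
by move=> /eqP ->; rewrite mulr0z.
Qed.

End RationalCoordinates.

(** The universal properties give additive maps g and g' with g' o g = id, and an additive map
    between rational vector spaces is linear. *)
Lemma tensor_dim_unique (A : zmodType) (V V' : vectType rat)
    (t : A -> rat -> V) (t' : A -> rat -> V') :
  is_tensor_rat t -> is_tensor_rat t' -> (\dim {:V} <= \dim {:V'})%N.
Proof.
move=> [tb _ tU] [tb' _ tU'].
have [g gt _] := tU _ _ tb'; have [g' gt' _] := tU' _ _ tb.
have gK : cancel g g'.
  have [f _ fU] := tU _ _ tb; move=> v.
  rewrite -[LHS]/((g' \o g) v) (fU (g' \o g)); last by move=> a q; rewrite /= gt.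
  by rewrite -(fU idfun).
pose gl : {linear V -> V'} := HB.pack (g : V -> V')
  (GRing.isZmodMorphism.Build _ _ (g : V -> V') (raddfB g))
  (GRing.isScalable.Build _ _ _ _ (g : V -> V') (rat_linear (raddfB g))).
have /lker0P ker0 : injective (linfun gl).
  by move=> u v; rewrite !lfunE /=; apply: can_inj gK _ _.
have <- := limg_dim_eq (f := linfun gl) (U := fullv); first exact/dimvS/subvf.
by rewrite (eqP ker0) capv0.
Qed.

(** Rational row vectors, with a (x) q sent to q times the coordinates of a, satisfy the universal
    property; uniqueness of the dimension then pins down the [xget] in [rank]. *)
Lemma rank_basis (A : zmodType) r (e : 'I_r -> A) : rational_basis e -> rank A = r.
Proof.
move=> eB; have [c [ce ctor]] := rational_coordinates eB; have [ind gen] := eB.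
pose t (a : A) (q : rat) : 'rV[rat]_r := q *: c a.
have tT : is_tensor_rat t.
  split.
  - split=> [a a' b|a b b']; first by rewrite /t raddfB scalerBr.
    by rewrite /t scalerBl.
  - by move=> a q q'; rewrite /t scalerA.
  - move=> W b [b1 b2].
    have b0 q : b 0 q = 0 by have := b1 0 0 q; rewrite !subrr.
    have b0' a : b a 0 = 0 by have := b2 a 0 0; rewrite !subrr.
    have bz a (k : int) q : b (a *~ k) q = b a q *~ k.
      pose f := mk_additive (fun a a' => b1 a a' q).
      by rewrite -[LHS]/(f (a *~ k)) raddfMz.
    have bq a q (k : int) : b a (q * k%:~R) = b a q *~ k.
      pose f := mk_additive (b2 a).
      by rewrite mulrzr -[LHS]/(f (q *~ k)) raddfMz.
    have gB (v w : 'rV[rat]_r) : \sum_i b (e i) ((v - w) 0 i) =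
        \sum_i b (e i) (v 0 i) - \sum_i b (e i) (w 0 i).
      by rewrite -sumrB; apply: eq_bigr => i _; rewrite !mxE b2.
    exists (mk_additive gB) => [a q|g' g'E v] /=.
      have [n n0 [k ak]] := gen a.
      have n_neq0 : (n%:R : rat) != 0 by rewrite pnatr_eq0 -lt0n.
      have cak i : c a 0 i = (k i)%:~R / n%:R.
        apply: (canRL (mulfK n_neq0)).
        have : c a *+ n = \row_j (k j)%:~R.
          rewrite -raddfMn ak /comb raddf_sum; apply/rowP => j.
          rewrite summxE (bigD1 j) //= raddfMz ce big1 ?addr0 => [|l lj].
            by rewrite mxE -scaler_int !mxE !eqxx mulr1.
          by rewrite raddfMz ce -scaler_int !mxE eq_sym (negPf lj) mulr0.
        by move/rowP/(_ i); rewrite mulmxnE mxE mulr_natr.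
      (* The denominator n of a is moved to the other argument of b, leaving an integral combination
         of the e i. *)
      transitivity (\sum_i b (e i *~ k i) (q / n%:R)).
        apply: eq_bigr => i _; rewrite bz mxE cak -bq; congr (b _ _).
        by rewrite mulrCA mulrC.
      pose f := mk_additive (fun a a' => b1 a a' (q / n%:R)).
      rewrite -[LHS]/(\sum_i f (e i *~ k i)) -raddf_sum -/(comb e k) -ak /=.
      by rewrite pmulrn bz -bq -pmulrn divfK.
    transitivity (g' (\sum_i t (e i) (v 0 i))).
      congr (g' _); rewrite [LHS]row_sum_delta; apply: eq_bigr => i _.
      by rewrite /t ce.
    by rewrite raddf_sum; apply: eq_bigr => i _; rewrite g'E.
have dimr : (\dim {:'rV[rat]_r})%VS = r by rewrite dimvf /dim /= mul1n.
rewrite /rank; apply: xget_unique.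
  by exists 'rV[rat]_r, t.
move=> d [V [t' [tT' <-]]]; have := tensor_dim_unique tT' tT.
have := tensor_dim_unique tT tT'; rewrite /= dimr => le1 le2.
by apply/eqP; rewrite eqn_leq le1 le2.
Qed.

(** The later sections see ranks of subgroups only through these properties, phrased with isolators
    so that no tensor product with a subgroup has to be formed. *)
Record rank_function (A : zmodType) (rk : subgroups A -> nat) : Prop := RankFunction {
  rk_le : forall H K : subgroups A, (forall x, x \in H -> isolated K x) -> (rk H <= rk K)%N;
  rk_isolated : forall H K : subgroups A, (forall x, x \in H -> isolated K x) ->
    (rk K <= rk H)%N -> forall x, x \in K -> isolated H x;
  rk_full : rk (full A) = rank A;
  rk_triv : rk (span [::]) = 0%N;
  rk_succ : forall (H K : subgroups A) x, {subset H <= K} -> x \in K -> ~ isolated H x ->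
    (forall z, z \in K -> exists2 n, (0 < n)%N & exists i : int, z *+ n - x *~ i \in H) ->
    rk K = (rk H).+1 }.

Section SubgroupRank.
Variables (A : zmodType) (r : nat) (e : 'I_r -> A).
Hypothesis eB : rational_basis e.
Variable c : {additive A -> 'rV[rat]_r}.
Hypotheses (ce : forall i, c (e i) = delta_mx 0 i)
  (ctor : forall x, c x = 0 -> exists2 n, (0 < n)%N & x *+ n = 0).
Implicit Types (H K : subgroups A).

Lemma span_coordinates (s : seq A) v : v \in <<map c s>>%VS ->
  exists2 n, (0 < n)%N & exists2 y, y \in span s & v *+ n = c y.
Proof.
elim: s v => [|z s IH] v /=.
  rewrite span_nil memv0 => /eqP ->; exists 1%N => //; exists 0; rewrite ?rpred0 //.
  by rewrite raddf0 mul0rn.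
rewrite span_cons => /memv_addP[_ /vlineP[q ->] [w /IH[n n0 [y ys wy]] ->]].
have d0 : denq q != 0 := denq_neq0 q; have := denq_gt0 q.
case dE : (denq q) => [d|//] d_gt0; exists (d * n)%N; first by rewrite muln_gt0 n0 andbT.
exists (z *~ (numq q * n%:Z) + y *+ d).
  apply: rpredD; first by apply/rpredMz/adjoin_self.
  by apply: rpredMn; apply: sub_adjoin.
rewrite raddfD raddfMz raddfMn -wy mulrnDl; congr (_ + _); last by zmod.
have -> : (q *: c z) *+ (d * n) = (d%:R * q) *: c z *+ n.
  by rewrite -scalerA scaler_nat -mulrnA.
have -> : d%:R * q = (numq q)%:~R.
  rewrite -[X in _ * X]divq_num_den dE mulrC divfK //.
  by rewrite pnatr_eq0 -lt0n.
by rewrite scaler_int mulrzA.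
Qed.

(** Take s in H spanning the largest possible dimension: no element of H can then enlarge the span,
    and clearing denominators gives the other direction. *)
Lemma rational_span H : exists s : seq A, {subset s <= H} /\
  forall x, c x \in <<map c s>>%VS <-> isolated H x.
Proof.
pose P d := `[< exists2 s : seq A, {subset s <= H} & \dim <<map c s>>%VS = d >].
have exP : exists d, P d by exists (\dim <<map c [::]>>%VS); apply/asboolP; exists [::].
have ubP d : P d -> (d <= \dim {:'rV[rat]_r})%N.
  by move=> /asboolP[s _ <-]; apply/dimvS/subvf.
have [d /asboolP[s sH sd] dmax] := ex_maxnP exP ubP.
exists s; split => // x; split.
  move=> /span_coordinates[n n0 [y ys xy]].
  have [m m0 xm] : exists2 m, (0 < m)%N & (x *+ n - y) *+ m = 0.
    by apply: ctor; rewrite raddfB raddfMn xy subrr.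
  exists (n * m)%N; first by rewrite muln_gt0 n0.
  have -> : x *+ (n * m) = (x *+ n - y) *+ m + y *+ m by zmod.
  by rewrite xm add0r rpredMn // (span_sub sH).
move=> [n n0 xnH].
have xnU : c (x *+ n) \in <<map c s>>%VS.
  have sub : (<<map c s>> <= <<map c (x *+ n :: s)>>)%VS by rewrite /= span_cons addvSr.
  suff /eqP -> : <<map c s>>%VS == <<map c (x *+ n :: s)>>%VS.
    by rewrite /= span_cons; apply: (subvP (addvSl _ _)); exact: memv_line.
  rewrite eqEdim sub sd; apply: dmax; apply/asboolP; exists (x *+ n :: s) => //.
  by move=> y; rewrite inE => /predU1P[->|/sH].
have n_neq0 : (n%:R : rat) != 0 by rewrite pnatr_eq0 -lt0n.
have -> : c x = n%:R^-1 *: c (x *+ n).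
  by rewrite raddfMn -scaler_nat scalerA mulVf // scale1r.
exact: memvZ.
Qed.

Lemma rank_function_exists : exists rk : subgroups A -> nat, rank_function rk.
Proof.
have /choice[s sP] := rational_span.
have sH H : {subset s H <= H} by case: (sP H).
have memU H x : c x \in <<map c (s H)>>%VS <-> isolated H x by case: (sP H).
have subU H K : (forall x, x \in H -> isolated K x) ->
    (<<map c (s H)>> <= <<map c (s K)>>)%VS.
  move=> HK; apply/span_subvP => _ /mapP[x xs ->].
  by apply/memU/HK/sH.
have iso H x : x \in H -> isolated H x by exists 1%N; rewrite ?mulr1n.
exists (fun H => \dim <<map c (s H)>>%VS); split.
- by move=> H K /subU/dimvS.
- move=> H K /subU HK KH x xK; apply/memU.
  suff /eqP -> : <<map c (s H)>>%VS == <<map c (s K)>>%VS by apply/memU/iso.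
  by rewrite eqEdim HK.
- rewrite (rank_basis eB).
  suff -> : <<map c (s (full A))>>%VS = fullv by rewrite dimvf /dim /= mul1n.
  apply/eqP; rewrite eqEsubv subvf /=; apply/subvP => v _.
  rewrite [v]row_sum_delta; apply: memv_suml => i _; apply: memvZ.
  by rewrite -ce; apply/memU/iso/mem_full.
- apply/eqP; rewrite dimv_eq0 -subv0; apply/span_subvP => _ /mapP[x xs ->].
  by have /asboolP -> := sH _ _ xs; rewrite raddf0 mem0v.
- move=> H K x HK xK nx Kx.
  have -> : <<map c (s K)>>%VS = (<<map c (s H)>> + <[c x]>)%VS.
    apply/eqP; rewrite eqEsubv; apply/andP; split.
      apply/span_subvP => _ /mapP[z zs ->].
      have [n n0 [i zx]] := Kx z (sH _ _ zs).
      have n_neq0 : (n%:R : rat) != 0 by rewrite pnatr_eq0 -lt0n.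
      have -> : c z = n%:R^-1 *: (c (z *+ n - x *~ i) + i%:~R *: c x).
        rewrite raddfB raddfMn raddfMz scaler_int subrK -scaler_nat scalerA.
        by rewrite mulVf // scale1r.
      apply/memvZ/memv_add; first by apply/memU/iso.
      by apply/memvZ/memv_line.
    rewrite subv_add subU => [|y /HK/iso//]; rewrite -memvE.
    by apply/memU/iso.
  have cx : c x \notin <<map c (s H)>>%VS by apply/negP => /memU.
  rewrite dimv_disjoint_sum ?dim_vline.
    suff -> : c x != 0 by rewrite addn1.
    by apply: contra cx => /eqP ->; rewrite mem0v.
  apply/eqP; rewrite -subv0; apply/subvP => v; rewrite memv_cap => /andP[vU /vlineP[q vE]].
  have [q0|q0] := eqVneq q 0; first by rewrite vE q0 scale0r mem0v.
  case/negP: cx; have -> : c x = q^-1 *: v by rewrite vE scalerA mulVf // scale1r.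
  exact: memvZ.
Qed.

End SubgroupRank.

Lemma rank_function_minimax (A : zmodType) (t : seq A) :
  (forall x, isolated (span t) x) -> exists rk : subgroups A -> nat, rank_function rk.
Proof.
move=> tor; have [r [e [ind gen]]] := independent_generators t.
have eB : rational_basis e.
  split => // y; have [n n0 /gen[m m0 [k yk]]] := tor y.
  exists (n * m)%N; first by rewrite muln_gt0 n0.
  by exists k; rewrite mulrnA.
have [c [ce ctor]] := rational_coordinates eB.
by apply: (@rank_function_exists A r e eB c).
Qed.

(** * Quotients isomorphic to powers of a quasicyclic group *)

Lemma quasicyclic_coprime (V : zmodType) (p : nat) (v : V) (d : int) :
  prime p -> quasicyclic p V -> ~~ (p%:Z %| d)%Z -> v *~ d = 0 -> v = 0.
Proof.
move=> p_pr qV pd vd; have [k vk] := quasicyclic_torsion qV v.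
have [a [b ab]] := @Bezout_pow d p k p_pr pd.
have -> : v = v *~ d *~ a + v *+ p ^ k *~ b.
  by rewrite -{1}[v]mulr1z -ab; zmod.
by rewrite vd vk !mul0rz addr0.
Qed.

Lemma divisible_int (V : zmodType) (v : V) (d : int) : divisible V -> d != 0 ->
  exists w, w *~ d = v.
Proof.
move=> divV; case: d => n d0.
  have [|w <-] := divV v n; first by rewrite lt0n -eqz_nat.
  by exists w.
by have [//|w wn] := divV (- v) n.+1; exists w; rewrite NegzE mulrNz -pmulrn wn opprK.
Qed.

Section QuasicyclicQuotients.
Variables (A V : zmodType) (p : nat).
Hypotheses (p_pr : prime p) (qV : quasicyclic p V).
Implicit Types (H K L : subgroups A).

(** f is nonzero on x and the successive p-power roots of x modulo H lie in L, so [f] takes values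
    of arbitrarily large order on L. L is A or a subgroup in the applications. *)
Lemma onto_quasicyclic H L x : x \notin H -> x *+ p \in H ->
  (forall k, exists2 y, y \in L & y *+ p ^ k - x \in H) ->
  exists f : {additive A -> V},
    (forall y, y \in H -> f y = 0) /\ forall v, exists2 y, y \in L & f y = v.
Proof.
move=> xH xp xdiv; have [f [fH fx fxp]] := quasicyclic_hom p_pr qV xH xp.
exists f; split => // v; have [k vk] := quasicyclic_torsion qV v.
have [y yL yx] := xdiv k.
have fy : f y *+ p ^ k = f x by apply/eqP; rewrite -subr_eq0 -raddfMn -raddfB fH.
have [||i ->] := quasicyclic_multiple qV (w := f y) (v := v) (k := k).
- by rewrite fy.
- by rewrite expnSr mulrnA vk mul0rn.
by exists (y *~ i); rewrite ?rpredMz // raddfMz.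
Qed.

(** A map onto V^j given by its coordinates, so that one of them can be replaced. *)
Definition onto_pow j (f : 'I_j -> {additive A -> V}) : Prop :=
  forall v : 'I_j -> V, exists x, forall i, f i x = v i.

Lemma maps_onto_pow j : maps_onto A {ffun 'I_j -> V} <-> exists f, @onto_pow j f.
Proof.
split=> [[F Fonto]|[f fonto]].
  have FB i x y : F (x - y) i = F x i - F y i by rewrite raddfB !ffunE.
  exists (fun i => mk_additive (FB i)) => v.
  by have [x xv] := Fonto [ffun i => v i]; exists x => i /=; rewrite xv ffunE.
have fB x y : [ffun i => f i (x - y)] = [ffun i => f i x] - [ffun i => f i y].
  by apply/ffunP => i; rewrite !ffunE raddfB.
exists (mk_additive fB) => v; have [x xv] := fonto v; exists x.
by apply/ffunP => i; rewrite ffunE xv.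
Qed.

(** A large power of p kills the finitely many values on t, and multiplying by it preserves
    surjectivity since V is divisible. *)
Lemma onto_pow_kill j (f : 'I_j -> {additive A -> V}) (t : seq A) : onto_pow f ->
  exists2 g, @onto_pow j g & forall i x, x \in span t -> g i x = 0.
Proof.
move=> fonto; have [K KP] : exists K : nat, forall i x, x \in t -> f i x *+ p ^ K = 0.
  have /choice[k kP] : forall ix : 'I_j * A, exists k : nat, f ix.1 ix.2 *+ p ^ k = 0.
    by move=> ix; apply: quasicyclic_torsion qV _.
  exists (\max_(x <- t) \max_i k (i, x))%N => i x xt.
  have kK : (k (i, x) <= \max_(x <- t) \max_i k (i, x))%N.
    by apply: leq_trans (leq_bigmax_seq _ xt isT); apply: leq_bigmax.
  by rewrite -(subnKC kK) expnD mulrnA (kP (i, x)) mul0rn.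
have gB i x y : f i (x - y) *+ p ^ K = f i x *+ p ^ K - f i y *+ p ^ K.
  by rewrite raddfB mulrnBl.
exists (fun i => mk_additive (gB i)) => [v|i x xt].
  have /choice[w wP] : forall i, exists w, w *+ p ^ K = v i.
    by move=> i; apply: (quasicyclic_divisible qV); rewrite expn_gt0 prime_gt0.
  by have [x xw] := fonto w; exists x => i /=; rewrite xw.
by apply/mem_kernel; apply: span_sub xt => y yt; apply/mem_kernel/KP.
Qed.

Section Bounded.
Variable t : seq A.
Hypotheses (dccZ : dcc (span t))
  (divZ : forall m x, (0 < m)%N -> exists y, x - y *+ m \in span t).

(** Each f i sends the p-torsion of A/Z into the subgroup of order p of V. Among the p^j
    combinations with coefficients below p, two take the same values on s, because there are only
    p^(size s) possible values; d is their difference. *)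
Lemma dependent_mod_p j (f : 'I_j -> {additive A -> V}) (s : seq A) :
  (size s < j)%N -> (forall x, x *+ p \in span t -> exists2 y, y \in s & x - y \in span t) ->
  (forall i x, x \in span t -> f i x = 0) ->
  exists (d : 'I_j -> int) (i0 : 'I_j), ~~ (p%:Z %| d i0)%Z /\
    forall x, x *+ p \in span t -> \sum_i f i x *~ d i = 0.
Proof.
move=> sj sP fZ; have [u u0 up] := quasicyclic_order_p qV.
have p0 := prime_gt0 p_pr.
have /choice[code codeP] : forall v : V, exists i : 'I_p, v *+ p = 0 -> v = u *+ i.
  move=> v; have [vp|nvp] := pselect (v *+ p = 0); last by exists (Ordinal p0).
  have [||i ->] := quasicyclic_multiple qV (w := u) (v := v) (k := 0%N).
  - by rewrite mulr1n.
  - by rewrite expn1.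
  have p_neq0 : p%:Z != 0 by rewrite eqz_nat -lt0n.
  have := modz_ge0 i p_neq0; have := ltz_mod i p_neq0; have := divz_eq i p.
  set q := (i %/ p)%Z; case: (i %% p)%Z => // r iE rp _.
  have rp' : (r < p)%N by lia.
  exists (Ordinal rp') => _ /=; rewrite iE.
  have -> : u *~ (q * p + r) = u *+ p *~ q + u *+ r by zmod.
  by rewrite up mul0rz add0r.
pose Phi (a : {ffun 'I_j -> 'I_p}) : {ffun 'I_(size s) -> 'I_p} :=
  [ffun l => code (\sum_i f i s`_(nat_of_ord l) *+ a i)].
have /injectivePn[a [a' aa' PhiE]] : ~~ injectiveb Phi.
  apply/negP => /injectiveP/leq_card; rewrite !card_ffun !card_ord leq_exp2l ?prime_gt1 //.
  by rewrite leqNgt sj.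
have [i0 ai0] : exists i, a i != a' i.
  by apply/existsP; apply: contraR aa' => /existsPn na; apply/eqP/ffunP => i; apply/eqP/negPn.
exists (fun i => (a i)%:Z - (a' i)%:Z), i0; split.
  have := ltn_ord (a i0); have := ltn_ord (a' i0) => la la'.
  apply/negP; rewrite dvdzE => /dvdn_leq; rewrite absz_gt0 subr_eq0 eqz_nat.
  by move=> /(_ ai0); move: la la'; rewrite /=; lia.
have sval y : y \in s -> y *+ p \in span t -> \sum_i f i y *~ ((a i)%:Z - (a' i)%:Z) = 0.
  move=> ys yp; have yl : (index y s < size s)%N by rewrite index_mem.
  have sump (b : 'I_j -> 'I_p) : (\sum_i f i y *+ b i) *+ p = 0.
    rewrite -sumrMnl big1 // => i _.
    have fyp : f i y *+ p = 0 by rewrite -raddfMn fZ.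
    by rewrite -mulrnA mulnC mulrnA fyp mul0rn.
  have := congr1 (fun F : {ffun 'I_(size s) -> 'I_p} => F (Ordinal yl)) PhiE.
  rewrite !ffunE /= nth_index // => cE.
  have : \sum_i f i y *+ a i = \sum_i f i y *+ a' i.
    by rewrite (codeP _ (sump a)) (codeP _ (sump a')) cE.
  move=> /eqP; rewrite -subr_eq0 -sumrB => /eqP e; rewrite -[RHS]e.
  by apply: eq_bigr => i _; zmod.
move=> x xp; have [y ys xy] := sP x xp.
rewrite -[RHS](sval y ys); last first.
  have -> : y *+ p = x *+ p - (x - y) *+ p by zmod.
  by rewrite rpredB // rpredMn.
apply: eq_bigr => i _; congr (_ *~ _); apply/eqP.
by rewrite -subr_eq0 -raddfB fZ.
Qed.

(** As A/Z is divisible, x = p h(x) modulo Z, with h(x) unique up to p-torsion of A/Z, on which g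
    vanishes; so g(h(x)) is well defined. *)
Lemma divide_by_p (g : {additive A -> V}) :
  (forall x, x *+ p \in span t -> g x = 0) ->
  exists g' : {additive A -> V}, (forall x, x \in span t -> g' x = 0) /\
    forall x, g' x *+ p = g x.
Proof.
move=> gS; have gZ x : x \in span t -> g x = 0 by move=> xt; apply: gS; apply: rpredMn.
have /choice[h hP] : forall x, exists y, x - y *+ p \in span t.
  by move=> x; apply/divZ/prime_gt0.
have ghE x y : x - y *+ p \in span t -> g (h x) = g y.
  move=> xy; apply/eqP; rewrite -subr_eq0 -raddfB gS //.
  have -> : (h x - y) *+ p = (x - y *+ p) - (x - h x *+ p) by zmod.
  exact: rpredB.
have g'B x y : g (h (x - y)) = g (h x) - g (h y).
  rewrite -raddfB; apply: ghE.
  have -> : x - y - (h x - h y) *+ p = (x - h x *+ p) - (y - h y *+ p) by zmod.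
  exact: rpredB.
exists (mk_additive g'B); split=> [x xt|x] /=.
  by rewrite (ghE _ 0) ?raddf0 // mul0rn subr0.
apply/eqP; rewrite -subr_eq0 -raddfMn -raddfB gZ //.
have -> : h x *+ p - x = - (x - h x *+ p) by zmod.
by rewrite rpredN.
Qed.

Fact joint_kernel_closed j (f : 'I_j -> {additive A -> V}) :
  zmod_closed (fun x => `[< forall i, f i x = 0 >]).
Proof.
split=> [|x y /asboolP fx /asboolP fy]; apply/asboolP => i; first exact: raddf0.
by rewrite raddfB fx fy subrr.
Qed.

(* For j larger than the number of representatives of the p-torsion of A/Z, some
   combination of the coordinates of f, nonzero mod p, vanishes on that torsion
   and is thus divisible by p; replacing a coordinate by the quotient keeps f onto
   and strictly shrinks the joint kernel, against the descending chain condition. *)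
Lemma onto_pow_bounded : exists B, forall j (f : 'I_j -> {additive A -> V}),
  onto_pow f -> (j <= B)%N.
Proof.
have [s sP] := dcc_fin_cosets dccZ (fun x xt => xt) p_pr.
exists (size s) => j f0 f0onto; rewrite leqNgt; apply/negP => sj.
have [f1 f1onto f1Z] := onto_pow_kill t f0onto.
pose jker (f : 'I_j -> {additive A -> V}) := Subgroup (joint_kernel_closed f).
have jkerP f x : x \in jker f <-> forall i, f i x = 0.
  by split=> [/asboolP|fx]; [|apply/asboolP].
have [|_ [f [fonto fZ ->]] fmin] := @dcc_min _ (span t) (fun L => exists f,
    [/\ onto_pow f, forall i x, x \in span t -> f i x = 0 & L = jker f]) dccZ _
    (ex_intro _ _ (ex_intro _ f1 (And3 f1onto f1Z erefl))).
  by move=> _ [f [_ fZ ->]] x xt; apply/jkerP => i; apply: fZ.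
have [d [i0 [di0 gS]]] := dependent_mod_p sj sP fZ.
have d0 : d i0 != 0 by apply: contraNneq di0 => ->; rewrite dvdz0.
have gB x y : \sum_i f i (x - y) *~ d i = \sum_i f i x *~ d i - \sum_i f i y *~ d i.
  by rewrite -sumrB; apply: eq_bigr => i _; rewrite raddfB mulrzBl.
have [g' [g'Z g'p]] := divide_by_p (g := mk_additive gB) gS.
pose f' i := if i == i0 then g' else f i.
have gE x : (forall i, i != i0 -> f i x = 0) -> \sum_i f i x *~ d i = f i0 x *~ d i0.
  by move=> fx; rewrite (bigD1 i0) //= big1 ?addr0 // => i /fx ->; rewrite mul0rz.
have f'onto : onto_pow f'.
  move=> v; have /choice[w wP] : forall i, exists w, w *+ p = v i.
    by move=> i; apply: (quasicyclic_divisible qV); exact: prime_gt0.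
  (* w0 makes the combination with coefficients d equal to p times [w i0]. Only p g' is known, hence
     the preimage x *+ p and the p-th parts w of v. *)
  have [w0 w0E] := divisible_int (w i0 *+ p - \sum_(i | i != i0) w i *~ d i)
    (quasicyclic_divisible qV) d0.
  have [x xE] := fonto (fun i => if i == i0 then w0 else w i).
  exists (x *+ p) => i; rewrite /f'; case: eqP => [->|/eqP ii0].
    rewrite raddfMn g'p /= (bigD1 i0) //= xE eqxx w0E.
    rewrite -(wP i0); apply/eqP; rewrite -addrA -[X in _ == X]addr0 (inj_eq (addrI _)).
    rewrite addrC subr_eq0; apply/eqP/eq_bigr => l li0.
    by rewrite xE (negPf li0).
  by rewrite raddfMn xE (negPf ii0).
have f'ker x : (forall i, f' i x = 0) -> forall i, f i x = 0.
  move=> f'x; have fx i : i != i0 -> f i x = 0.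
    by move=> ii0; have := f'x i; rewrite /f' (negPf ii0).
  move=> i; have [->|/fx//] := eqVneq i i0.
  apply: (quasicyclic_coprime p_pr qV di0); rewrite -gE //.
  have := g'p x; rewrite /= => <-; have := f'x i0; rewrite /f' eqxx => ->.
  by rewrite mul0rn.
have [u u0 up] := quasicyclic_order_p qV.
(* This x is outside the kernel of f' but in that of f: [f i0 x] times [d i0] is p u = 0, and [d i0]
   is prime to p. *)
have [x xE] := f'onto (fun i => if i == i0 then u else 0).
have : x \in jker f.
  apply/jkerP; have fx i : i != i0 -> f i x = 0.
    by move=> ii0; have := xE i; rewrite /f' (negPf ii0).
  move=> i; have [->|/fx//] := eqVneq i i0.
  apply: (quasicyclic_coprime p_pr qV di0); rewrite -gE //.
  by have := g'p x; rewrite /= => <-; have := xE i0; rewrite /f' eqxx => ->.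
rewrite -(fmin (jker f')) => [/jkerP/(_ i0)||y /jkerP/f'ker fy]; last exact/jkerP.
  by have := xE i0; rewrite /f' eqxx => -> /eqP; rewrite (negPf u0).
exists f'; split => // i y yt; rewrite /f'; case: eqP => _; first exact: g'Z.
exact: fZ.
Qed.

Lemma onto_torsion N (f : {additive A -> V}) : 
  (forall q, prime q -> (N < q)%N -> forall x, x *+ q \in span t -> x \in span t) ->
  (forall v, exists x, f x = v) -> (p <= N)%N.
Proof.
move=> NP fonto; rewrite leqNgt; apply/negP => Np.
have [|g gonto gZ] := @onto_pow_kill 1 (fun=> f) t.
  by move=> v; have [x xv] := fonto (v ord0); exists x => i; rewrite ord1.
have [u u0 up] := quasicyclic_order_p qV.
have [x /(_ ord0) xu] := gonto (fun=> u).
have [n n0 xn] := dcc_torsion x dccZ.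
have [n' cop nE] := pfactor_coprime p_pr n0.
have pXt a y : y *+ p ^ a \in span t -> y \in span t.
  elim: a => [|a IH]; first by rewrite mulr1n.
  by rewrite expnSr mulrnA => /(NP p p_pr Np)/IH.
have := gZ ord0 (x *+ n'); rewrite nE mulrnA in xn.
move=> /(_ (pXt _ _ xn)); rewrite raddfMn xu => un.
case/eqP: u0; apply: (quasicyclic_coprime (d := n'%:Z) p_pr qV) => //.
by rewrite dvdzE /= -prime_coprime.
Qed.

End Bounded.
End QuasicyclicQuotients.

(** * The numbers ell_p and critical primes *)

Section Ell.
Variables (A : zmodType) (t : seq A).
Hypotheses (dccZ : dcc (span t))
  (divZ : forall m x, (0 < m)%N -> exists y, x - y *+ m \in span t).

(** The bound on j ensures that the [xget] in [ell] returns a true maximum. *)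
Lemma ellP p : prime p ->
  maps_onto A {ffun 'I_(ell p A) -> prufer p} /\
  forall j, maps_onto A {ffun 'I_j -> prufer p} -> (j <= ell p A)%N.
Proof.
move=> p_pr; have qV := prufer_quasicyclic p_pr.
have [B BP] := onto_pow_bounded p_pr qV dccZ divZ.
apply: (xgetPex 0%N (P := [set k | maps_onto A {ffun 'I_k -> prufer p} /\
    forall j, maps_onto A {ffun 'I_j -> prufer p} -> (j <= k)%N])).
pose P j := `[< maps_onto A {ffun 'I_j -> prufer p} >].
have exP : exists j, P j.
  exists 0%N; apply/asboolP/maps_onto_pow.
  by exists (fun i : 'I_0 =>
    mk_additive (fun x y : A => esym (subr0 (0 : prufer p)))) => v; exists 0 => -[].
have ubP j : P j -> (j <= B)%N by move=> /asboolP/maps_onto_pow[f] /BP.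
have [k /asboolP kP kmax] := ex_maxnP exP ubP.
by exists k; split => // j jP; apply: kmax; apply/asboolP.
Qed.

Lemma ell_gt0P p : prime p -> (0 < ell p A)%N <->
  exists f : {additive A -> prufer p}, forall v, exists x, f x = v.
Proof.
move=> p_pr; have [onto mx] := ellP p_pr; split=> [l0|[f fonto]].
  have /maps_onto_pow[f fonto] := onto; exists (f (Ordinal l0)) => v.
  by have [x xv] := fonto (fun=> v); exists x; apply: xv.
apply: mx; apply/maps_onto_pow; exists (fun=> f) => v.
by have [x xv] := fonto (v ord0); exists x => i; rewrite ord1.
Qed.

Lemma ell_large : exists N, forall p, prime p -> (0 < ell p A)%N -> (p <= N)%N.
Proof.
have [N NP] := dcc_no_large_torsion dccZ (fun x xt => xt).
exists N => p p_pr /(ell_gt0P p_pr)[f fonto].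
exact: (onto_torsion p_pr (prufer_quasicyclic p_pr) dccZ NP fonto).
Qed.

(** f comes from the Pruefer group in A/H and kills H; g is already onto on H. Correcting the value
    of g by elements of H leaves f unchanged, so (f, g) is onto. *)
Lemma two_quasicyclic_critical p (H K : subgroups A) x y : prime p -> {subset K <= H} ->
  x \notin H -> x *+ p \in H -> (forall k, exists z, z *+ p ^ k - x \in H) ->
  y \notin K -> y *+ p \in K -> (forall k, exists2 z, z \in H & z *+ p ^ k - y \in K) ->
  critical A.
Proof.
move=> p_pr KH xH xp xdiv yK yp ydiv; have qV := prufer_quasicyclic p_pr.
have [|f [fH fonto]] := onto_quasicyclic (L := full A) p_pr qV xH xp.
  by move=> k; have [z zx] := xdiv k; exists z => //; exact: mem_full.
have [g [gK gonto]] := onto_quasicyclic p_pr qV yK yp ydiv.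
exists p; split => //; apply: (ellP p_pr).2; apply/maps_onto_pow.
exists (fun i => if i == ord0 then f else g) => v.
have [a _ fa] := fonto (v ord0); have [b bH gb] := gonto (v ord_max - g a).
exists (a + b) => i; case: (unliftP ord0 i) => [j ->|->] /=; last first.
  by rewrite raddfD fa fH // addr0.
rewrite (_ : lift ord0 j = ord_max); last by apply: val_inj; rewrite /= ord1.
by rewrite raddfD gb addrC subrK.
Qed.

End Ell.

(** * The rank function on the space of subgroups *)

(** N will be a bound for the primes with ell_p > 0; unbounded primes are among them. *)
Definition nb_unbounded (A : zmodType) (N : nat) (H : subgroups A) : nat :=
  (\sum_(p < N.+1 | prime p) `[< unbounded p H >])%N.

(** An element of order p^(m+1) modulo H would be killed by p^b = gcd(p^(m+1), m), but p^b <= m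
    gives b <= m. *)
Lemma unbounded_exponent (A : zmodType) (H : subgroups A) p m : prime p -> (0 < m)%N ->
  (forall w j, w *+ p ^ j \in H -> w *+ m \in H) -> ~ unbounded p H.
Proof.
move=> p_pr m0 Hm /(_ m)[w [w1 w2]]; case/negP: w2.
have := rpred_gcd w1 (Hm _ _ w1).
have /(dvdn_pfactor _ _ p_pr)[b _ gE] := dvdn_gcdl (p ^ m.+1) m.
rewrite gE => wb; have bm : (b <= m)%N.
  have : (p ^ b %| m)%N by rewrite -gE dvdn_gcdr.
  by move=> /(dvdn_leq m0); apply: leq_trans; rewrite ltnW // ltn_expl // prime_gt1.
by rewrite -(subnKC bm) expnD mulrnA rpredMn.
Qed.

(** * Every other subgroup near H has larger corank *)

Section Corank.
Variables (A : zmodType) (t : seq A).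
Hypotheses (dccZ : dcc (span t))
  (divZ : forall m x, (0 < m)%N -> exists y, x - y *+ m \in span t)
  (noncrit : ~ critical A).
Variable rk : subgroups A -> nat.
Hypothesis rkP : rank_function rk.
Variable N : nat.
Hypothesis ellN : forall p, prime p -> (0 < ell p A)%N -> (p <= N)%N.
Implicit Types (H K : subgroups A) (x y z : A).

Let finA H : finite_socle H := dcc_finite_socle H dccZ (fun=> erefl).

Lemma unbounded_ell p H : prime p -> unbounded p H -> (0 < ell p A)%N.
Proof.
move=> p_pr /(unboundedP finA p_pr)[x [xH xp xdiv]].
apply/(ell_gt0P dccZ divZ p_pr).
have [|f [_ fonto]] := onto_quasicyclic (L := full A) p_pr (prufer_quasicyclic p_pr) xH xp.
  by move=> k; have [y yx] := xdiv k; exists y => //; exact: mem_full.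
by exists f => v; have [y _ fy] := fonto v; exists y.
Qed.

Lemma unbounded_le p H : prime p -> unbounded p H -> (p <= N)%N.
Proof. by move=> p_pr /(unbounded_ell p_pr)/(ellN p_pr). Qed.

Lemma ell_le1 p : prime p -> (ell p A <= 1)%N.
Proof. by move=> p_pr; rewrite leqNgt; apply/negP => l2; apply: noncrit; exists p. Qed.

Lemma heightE : height A = (rank A + \sum_(p < N.+1 | prime p) ell p A)%N.
Proof.
rewrite /height; congr addn.
rewrite (@fsbigE _ _ _ _ _ [seq p <- iota 0 N.+1 | prime p]) ?filter_uniq ?iota_uniq //.
- rewrite big_filter_cond -(big_mkord (fun p => prime p) (fun p => ell p A)).
  rewrite /index_iota subn0; apply: eq_bigl => p.
  by rewrite andb_idr // => p_pr; apply/mem_set.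
- by move=> p /=; rewrite mem_filter => /andP[].
- move=> p /= p_pr; rewrite mem_filter p_pr mem_iota /= => pN'.
  have pN : (N < p)%N by rewrite prime_gt0 //= -leqNgt add1n in pN'.
  by apply/eqP; rewrite -leqn0 leqNgt; apply/negP => /(ellN p_pr); rewrite leqNgt pN.
Qed.

(** The complement to h(A) of the rank of the point H in S(A). *)
Definition corank H : nat := (rk H + nb_unbounded N H)%N.

Lemma corank_le H : (corank H <= height A)%N.
Proof.
rewrite heightE leq_add //.
  by rewrite -(rk_full rkP); apply: (rk_le rkP) => x _; exists 1%N; rewrite ?mem_full.
apply: leq_sum => p p_pr; case: asboolP => // /(unbounded_ell p_pr).
by [].
Qed.

Lemma p_torsion_kill (K : subgroups A) x p n : prime p -> (0 < n)%N -> x *+ n \in K ->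
  exists a n', coprime p n' /\ x *+ n' *+ p ^ a \in K.
Proof.
move=> p_pr n0 xn; have [n' cop nE] := pfactor_coprime p_pr n0.
by exists (logn p n), n'; rewrite -mulrnA -nE.
Qed.

Lemma corank_isolated H : exists s : seq A, forall K,
  (forall x, x \in s -> (x \in K) = (x \in H)) -> K = H \/ (corank H < corank K)%N.
Proof.
have [t' [t'H _ Htor Hdiv]] := divisible_core dccZ (fun=> erefl) H.
have [F1 F1P] := socle_reps finA H.
have [F2 F2P] := socle_reps finA (span t').
exists (t' ++ F1 ++ F2) => K Ks.
have t'K : {subset span t' <= K}.
  apply: span_sub => x xt; rewrite Ks ?mem_cat ?xt //.
  exact/t'H/mem_span.
(* A p-torsion element of the divisible group H/H' would start a Pruefer group inside H, besides the
   one in A/H. *)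
have noT p x a : prime p -> unbounded p H -> x \in H -> x *+ p ^ a \in span t' ->
    x \in span t'.
  move=> p_pr unb; elim: a x => [|a IH] x xH xa; first by rewrite mulr1n in xa.
  have xp : x *+ p \in span t' by apply: IH; [exact: rpredMn|rewrite -mulrnA -expnS].
  apply: contraT => xt'; case: noncrit.
  have [y [yH yp ydiv]] := unboundedP finA p_pr unb.
  apply: (two_quasicyclic_critical dccZ divZ p_pr t'H yH yp ydiv xt' xp) => k.
  have [|z zH xz] := Hdiv (p ^ k)%N x _ xH; first by rewrite expn_gt0 prime_gt0.
  by exists z => //; rewrite -opprB rpredN.
have noTcop p x : prime p -> unbounded p H -> x \in H ->
    exists2 n, coprime p n & x *+ n \in span t'.
  move=> p_pr unb xH; have [n n0 xn] := Htor x xH.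
  have [a [n' [cop xa]]] := p_torsion_kill p_pr n0 xn.
  by exists n' => //; apply: (noT p _ a p_pr unb) => //; rewrite rpredMn.
(* Multiplied by a suitable n prime to p, x has order dividing p modulo H', where the test elements
   F2 apply. *)
have step p x : prime p -> unbounded p H -> x \in K -> x *+ p \in H -> x \in H.
  move=> p_pr unb xK xp; have [n cop xn] := noTcop p _ p_pr unb xp.
  suff xnH : x *+ n \in H by apply: rpred_coprime cop xp xnH.
  have [|f fF xf] := F2P p (x *+ n) p_pr; first by rewrite -mulrnA mulnC mulrnA.
  have fK : f \in K.
    have -> : f = x *+ n - (x *+ n - f) by zmod.
    by rewrite rpredB ?rpredMn // t'K.
  have fH : f \in H by rewrite -Ks // !mem_cat fF !orbT.
  have -> : x *+ n = (x *+ n - f) + f by zmod.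
  by rewrite rpredD // t'H.
have unbK p : prime p -> unbounded p H -> unbounded p K.
  move=> p_pr unb k; have [w [w1 w2]] := unb k.
  have [n cop wn] := noTcop p _ p_pr unb w1.
  exists (w *+ n); rewrite -!mulrnA ![(n * _)%N]mulnC !mulrnA; split; first exact: t'K.
  apply/negP => wK; case/negP: w2.
  have wp : w *+ p ^ k *+ p \in H by rewrite -mulrnA -expnSr.
  apply: (rpred_coprime cop wp); apply: (step p) => //.
  by rewrite -mulrnA mulnC mulrnA rpredMn.
have rkHK : (rk H <= rk K)%N.
  by apply: (rk_le rkP) => x /Htor[n n0 xn]; exists n => //; exact: t'K.
have eHK p : prime p -> (`[< unbounded p H >] <= `[< unbounded p K >])%N.
  by move=> p_pr; case: asboolP => // /(unbK p p_pr) /asboolP ->.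
have [lt|le] := ltnP (corank H) (corank K); [by right|left].
(* Both terms of the corank can only grow from H to K; if their sum does not, each is unchanged. *)
have leE : (nb_unbounded N H <= nb_unbounded N K)%N.
  by apply: leq_sum => p p_pr; apply: eHK.
have rkE : (rk K <= rk H)%N by move: le leE; rewrite /corank; lia.
have eE : (nb_unbounded N K <= nb_unbounded N H)%N by move: le rkHK; rewrite /corank; lia.
have unbH p : prime p -> unbounded p K -> unbounded p H.
  move=> p_pr unb; have pN : (p < N.+1)%N := unbounded_le p_pr unb.
  apply: contrapT => nunb; move: eE; rewrite leqNgt => /negP; apply.
  rewrite /nb_unbounded (bigD1 (Ordinal pN)) //= [X in (_ < X)%N](bigD1 (Ordinal pN)) //=.
  rewrite (asboolF nunb) (asboolT unb) add0n add1n ltnS.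
  by apply: leq_sum => q /andP[q_pr _]; apply: eHK.
(* An element of H of order p modulo K has p-power roots in H modulo H', so p is unbounded for K,
   hence for H; but then H/H' has no p-torsion. *)
have HK : {subset H <= K}.
  move=> x xH; apply: contraT => xK.
  have [n n0 /t'K xn] := Htor x xH.
  have [i [p [p_pr _ yK yp]]] := torsion_prime n0 xn xK.
  set y := x *+ i in yK yp; have yH : y \in H by rewrite rpredMn.
  have unb : unbounded p H.
    apply: unbH => // k; have [|z zH yz] := Hdiv (p ^ k)%N y _ yH.
      by rewrite expn_gt0 prime_gt0.
    have zE : z *+ p ^ k = y - (y - z *+ p ^ k) by zmod.
    exists z; split; rewrite ?expnSr ?mulrnA zE.
      have -> : (y - (y - z *+ p ^ k)) *+ p = y *+ p - (y - z *+ p ^ k) *+ p by zmod.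
      by rewrite rpredB // rpredMn // t'K.
    apply: contra yK => zK; have -> : y = (y - (y - z *+ p ^ k)) + (y - z *+ p ^ k) by zmod.
    by rewrite rpredD // t'K.
  have [m cop ym] := noTcop p y p_pr unb yH.
  by case/negP: yK; apply: rpred_coprime cop yp (t'K _ ym).
apply: subgroup_ext => x; apply/idP/idP; last exact: HK.
move=> xK; apply: contraT => xH.
have [n n0 xn] := rk_isolated rkP (fun y yH => ex_intro2 _ _ 1%N isT (HK y yH)) rkE xK.
have [i [p [p_pr _ yH yp]]] := torsion_prime n0 xn xH.
have [f fF yf] := F1P p _ p_pr yp.
case/negP: yH; have -> : x *+ i = (x *+ i - f) + f by zmod.
rewrite rpredD // -Ks ?mem_cat ?fF ?orbT //.
have -> : f = x *+ i - (x *+ i - f) by zmod.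
by rewrite rpredB ?rpredMn // HK.
Qed.

End Corank.

(** H/K is a p-group, on which the q-parts do not depend. *)
Lemma unbounded_index_p (A : zmodType) (H K : subgroups A) p q : prime p -> prime q ->
  q != p -> {subset K <= H} -> (forall h, h \in H -> exists j : nat, h *+ p ^ j \in K) ->
  unbounded q K <-> unbounded q H.
Proof.
move=> p_pr q_pr qp KH HK.
have cop j : coprime (p ^ j) q.
  by rewrite coprime_sym coprimeXr // prime_coprime // dvdn_prime2.
split=> unb k; have [w [w1 w2]] := unb k.
  exists w; split; first exact: KH.
  apply: contra w2 => /HK[j wj]; apply: (rpred_coprime (cop j) wj).
  by rewrite -mulrnA -expnSr.
have [j wj] := HK _ w1; exists (w *+ p ^ j).
have swap i : w *+ p ^ j *+ q ^ i = w *+ q ^ i *+ p ^ j by zmod.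
rewrite !swap; split => //; apply: contra w2 => /KH wk.
by apply: (rpred_coprime (cop j) wk); rewrite -mulrnA -expnSr.
Qed.

Lemma eq_of_mulrz (A : zmodType) (H : subgroups A) (x : A) (i : int) : ~ isolated H x ->
  x *~ i \in H -> i = 0.
Proof.
move=> nx xi; apply: contrapT => /eqP i0; apply: nx.
by exists `|i|%N; rewrite ?absz_gt0 // rpred_absz.
Qed.

(** * Subgroups near H of corank one more *)

Section CorankSucc.
Variables (A : zmodType) (t : seq A).
Hypotheses (dccZ : dcc (span t))
  (divZ : forall m x, (0 < m)%N -> exists y, x - y *+ m \in span t)
  (noncrit : ~ critical A).
Variable rk : subgroups A -> nat.
Hypothesis rkP : rank_function rk.
Variable N : nat.
Hypothesis ellN : forall p, prime p -> (0 < ell p A)%N -> (p <= N)%N.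
Implicit Types (H K : subgroups A) (x y z : A).

(** K is the kernel in H of p^k f, where f maps A onto the Pruefer group and k is large enough for K
    to keep the elements of s in H. Then H/K is a Pruefer group: p becomes unbounded, and neither
    the rank nor the other primes change. *)
Lemma corank_succ_prufer H (s : seq A) p : (forall x, isolated H x) ->
  prime p -> (0 < ell p A)%N -> ~ unbounded p H ->
  exists2 K : subgroups A, forall x, x \in s -> (x \in K) = (x \in H) &
    corank rk N K = (corank rk N H).+1.
Proof.
move=> Hiso p_pr l0 nunb; have qV := prufer_quasicyclic p_pr.
have pX0 k : (0 < p ^ k)%N by rewrite expn_gt0 prime_gt0.
have [f fonto] := (ell_gt0P dccZ divZ p_pr).1 l0.
have [k0 k0P] := boundedP nunb.
(* f stays onto on H. Write v = p^k0 f(x), where p^k0 kills the p-part of A/H: some n' prime to p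
   puts p^k0 n' x in H, and n' is inverted modulo the order of v. *)
have fH v : exists2 h, h \in H & f h = v.
  have [w wv] := quasicyclic_divisible qV v (pX0 k0).
  have [x xw] := fonto w; have [n n0 xn] := Hiso x.
  have [a [n' [cop xa]]] := p_torsion_kill p_pr n0 xn.
  have [c vc] := quasicyclic_torsion qV v.
  have [|u [b ub]] := @Bezout_pow n'%:Z p c p_pr; first by rewrite dvdzE /= -prime_coprime.
  exists (x *+ n' *+ p ^ k0 *~ u); first by rewrite rpredMz // (k0P _ a).
  rewrite raddfMz !raddfMn /= xw.
  have -> : w *+ n' *+ p ^ k0 *~ u = w *+ p ^ k0 *~ (u * n'%:Z) by zmod.
  rewrite wv -[RHS]mulr1z -ub.
  have -> : v *~ (u * n'%:Z + b * (p ^ c)%N%:Z) = v *~ (u * n'%:Z) + v *+ p ^ c *~ b by zmod.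
  by rewrite vc mul0rz addr0.
have [k kP] : exists k : nat, forall x, x \in s -> f x *+ p ^ k = 0.
  elim: s => [|z s [k kP]]; first by exists 0%N.
  have [l zl] := quasicyclic_torsion qV (f z).
  exists (k + l)%N => x; rewrite inE expnD mulrnA => /predU1P[->|/kP ->].
    by rewrite -mulrnA mulnC mulrnA zl mul0rn.
  by rewrite mul0rn.
have gB x y : f (x - y) *+ p ^ k = f x *+ p ^ k - f y *+ p ^ k.
  by rewrite raddfB mulrnBl.
pose K := cap H (kernel (mk_additive gB)).
have KE x : (x \in K) <-> x \in H /\ f x *+ p ^ k = 0.
  rewrite mem_cap; split=> [/andP[xH xK]|[-> fx]]; last exact/mem_kernel.
  by split => //; have := (mem_kernel _ _).1 xK.
have KH : {subset K <= H} by move=> x /KE[].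
have HK h : h \in H -> exists j : nat, h *+ p ^ j \in K.
  move=> hH; have [j hj] := quasicyclic_torsion qV (f h); exists j.
  by apply/KE; rewrite rpredMn // raddfMn hj mul0rn.
exists K => [x xs|]; first by apply/idP/idP => [/KH|xH] //; apply/KE; rewrite kP.
have rkE : rk K = rk H.
  apply/eqP; rewrite eqn_leq; apply/andP; split; apply: (rk_le rkP) => x xK.
    by exists 1%N; rewrite ?mulr1n // KH.
  by have [j xj] := HK x xK; exists (p ^ j)%N.
have unb : unbounded p K.
  move=> j; have [u u0 up] := quasicyclic_order_p qV.
  have [w wu] := quasicyclic_divisible qV u (pX0 (j + k)%N).
  have [h hH hw] := fH w; exists h; split.
    apply/KE; rewrite rpredMn // raddfMn hw -mulrnA -expnD addSn expnS mulnC mulrnA wu.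
    by rewrite up.
  apply/negP => /KE[_]; rewrite raddfMn hw -mulrnA -expnD wu => /eqP.
  by rewrite (negPf u0).
rewrite /corank rkE -addnS; congr addn.
have pN : (p < N.+1)%N := ellN p_pr l0.
rewrite /nb_unbounded (bigD1 (Ordinal pN)) //= [in RHS](bigD1 (Ordinal pN)) //=.
rewrite (asboolT unb) (asboolF nunb) add0n add1n; congr S.
apply: eq_bigr => q /andP[q_pr qp]; congr (nat_of_bool _); apply/asboolP/asboolP.
  by move/(unbounded_index_p p_pr q_pr qp KH HK).
by move/(unbounded_index_p p_pr q_pr qp KH HK).
Qed.

Section RankSucc.
Variables (H : subgroups A) (x : A).
Hypothesis nx : ~ isolated H x.

(** The numbers by which x gets divided. If x could be divided further by a bounded prime, that
    prime might become unbounded; unbounded primes are excluded to keep an exponent for the torsion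
    modulo H. *)
Definition bounded_number (n : nat) : Prop :=
  (0 < n)%N /\ forall p, prime p -> (p %| n)%N -> (p <= N)%N /\ ~ unbounded p H.

Lemma bounded_numberM m n : bounded_number m -> bounded_number n -> bounded_number (m * n).
Proof.
move=> [m0 mP] [n0 nP]; split; first by rewrite muln_gt0 m0.
by move=> p p_pr; rewrite Euclid_dvdM // => /orP[/(mP p p_pr)|/(nP p p_pr)].
Qed.

Lemma bounded_number_pow p j : prime p -> (p <= N)%N -> ~ unbounded p H ->
  bounded_number (p ^ j).
Proof.
move=> p_pr pN nunb; split; first by rewrite expn_gt0 prime_gt0.
move=> q q_pr; rewrite Euclid_dvdX // => /andP[qp _].
by move: qp; rewrite dvdn_prime2 // => /eqP ->.
Qed.

Fact bounded_closure_closed : zmod_closed (fun y =>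
  `[< exists2 n, bounded_number n & y *+ n \in adjoin H x >]).
Proof.
split=> [|y z /asboolP[m mP ym] /asboolP[n nP zn]]; apply/asboolP.
  exists 1%N; last by rewrite mul0rn rpred0.
  by split => // p p_pr; rewrite dvdn1 => /eqP p1; rewrite p1 in p_pr.
exists (m * n)%N; first exact: bounded_numberM.
have -> : (y - z) *+ (m * n) = y *+ m *+ n - z *+ n *+ m by zmod.
by rewrite rpredB // rpredMn.
Qed.

Definition bounded_closure : subgroups A := Subgroup bounded_closure_closed.

Lemma bounded_closureP y :
  (y \in bounded_closure) <-> exists2 n, bounded_number n & y *+ n \in adjoin H x.
Proof. by split=> [/asboolP|]; [|move=> ?; apply/asboolP]. Qed.

Lemma bounded_torsion_exponent : exists2 c, (0 < c)%N &
  forall y, y \in bounded_closure -> isolated H y -> y *+ c \in H.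
Proof.
have /choice[k kP] : forall p, exists k, ~ unbounded p H ->
    forall w j, w *+ p ^ j \in H -> w *+ p ^ k \in H.
  move=> p; have [unb|/boundedP[k kP]] := pselect (unbounded p H); first by exists 0%N.
  by exists k.
(* Each bounded p contributes the exponent of the p-part of A/H; unbounded primes have [k p] = 0. *)
exists (\prod_(p < N.+1 | prime p) p ^ k p)%N.
  by apply: prodn_cond_gt0 => p p_pr; rewrite expn_gt0 prime_gt0.
set c := (\prod_(_ < _ | _) _)%N => y /bounded_closureP[n [n0 nP] /mem_adjoin[i yi]].
move=> [m m0 ym]; have yn : y *+ n \in H.
  suff i0 : i = 0 by rewrite i0 mulr0z subr0 in yi.
  have : x *~ (i * m) \in H.
    have -> : x *~ (i * m) = y *+ m *+ n - (y *+ n - x *~ i) *+ m by zmod.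
    by rewrite rpredB // rpredMn.
  by move/(eq_of_mulrz nx)/eqP; rewrite mulf_eq0 eqz_nat (gtn_eqF m0) orbF => /eqP.
apply: contraT => yc; have ycn : y *+ c *+ n \in H by rewrite -mulrnA mulnC mulrnA rpredMn.
have [j [p [p_pr pn yj yjp]]] := torsion_prime n0 ycn yc.
have [pN nunb] := nP p p_pr pn; have pN' : (p < N.+1)%N by [].
have cE : c = (p ^ k p * (c %/ p ^ k p))%N.
  by rewrite mulnC divnK // /c (bigD1 (Ordinal pN')) //= dvdn_mulr.
have zE : y *+ c *+ j = y *+ (c %/ p ^ k p * j) *+ p ^ k p by rewrite {1}cE; zmod.
case/negP: yj; rewrite zE; apply: (kP p nunb _ (k p).+1).
by rewrite expnSr mulrnA -zE.
Qed.

Variables (c q : nat).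
Hypotheses (c0 : (0 < c)%N) (q_pr : prime q) (Nq : (N < q)%N)
  (cP : forall y, y \in bounded_closure -> isolated H y -> y *+ c \in H).

(** The subgroup H + q^k c B, B being the bounded closure: c removes the torsion of B modulo H, and
    the powers of q, a prime to all bounded numbers, drive it away from any given element outside
    H. *)
Fact scaled_closed k : zmod_closed (fun z =>
  `[< exists2 y, y \in bounded_closure & z - y *+ (q ^ k * c) \in H >]).
Proof.
split=> [|z z' /asboolP[y yB zy] /asboolP[y' yB' zy']]; apply/asboolP.
  by exists 0; rewrite ?rpred0 // mul0rn subr0 rpred0.
exists (y - y'); first exact: rpredB.
have -> : z - z' - (y - y') *+ (q ^ k * c) =
  (z - y *+ (q ^ k * c)) - (z' - y' *+ (q ^ k * c)) by zmod.
exact: rpredB.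
Qed.

Definition scaled k : subgroups A := Subgroup (scaled_closed k).

Lemma scaledP k z : (z \in scaled k) <->
  exists2 y, y \in bounded_closure & z - y *+ (q ^ k * c) \in H.
Proof. by split=> [/asboolP|]; [|move=> ?; apply/asboolP]. Qed.

Lemma sub_scaled k : {subset H <= scaled k}.
Proof. by move=> h hH; apply/scaledP; exists 0; rewrite ?rpred0 // mul0rn subr0. Qed.

Lemma qc_gt0 k : (0 < q ^ k * c)%N.
Proof. by rewrite muln_gt0 expn_gt0 prime_gt0. Qed.

Lemma scaled_isolated k z : z \in scaled k -> isolated H z -> z \in H.
Proof.
move=> /scaledP[y yB zy] [n n0 zn]; set m := (q ^ k * c)%N in zy.
have yH : isolated H y.
  exists (m * n)%N; first by rewrite muln_gt0 qc_gt0.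
  have -> : y *+ (m * n) = z *+ n - (z - y *+ m) *+ n by zmod.
  by rewrite rpredB // rpredMn.
have -> : z = (z - y *+ m) + y *+ c *+ (q ^ k).
  by rewrite -mulrnA [(c * _)%N]mulnC subrK.
by rewrite rpredD // rpredMn // cP.
Qed.

Lemma scaled_mem k : x *+ (q ^ k * c) \in scaled k.
Proof.
apply/scaledP; exists x; last by rewrite subrr rpred0.
apply/bounded_closureP; exists 1%N; last by rewrite mulr1n adjoin_self.
by split => // p p_pr; rewrite dvdn1 => /eqP p1; rewrite p1 in p_pr.
Qed.

Lemma rk_scaled k : rk (scaled k) = (rk H).+1.
Proof.
apply: (rk_succ rkP (x := x *+ (q ^ k * c))); first exact: sub_scaled.
- exact: scaled_mem.
- move=> [n n0 xn]; apply: nx; exists (q ^ k * c * n)%N; last by rewrite mulrnA.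
  by rewrite muln_gt0 qc_gt0.
- move=> z /scaledP[y /bounded_closureP[n [n0 _] /mem_adjoin[i yi]] zy].
  exists n => //; exists i; set m := (q ^ k * c)%N in zy *.
  have -> : z *+ n - x *+ m *~ i = (z - y *+ m) *+ n + (y *+ n - x *~ i) *+ m by zmod.
  by rewrite rpredD // rpredMn.
Qed.

(** There is no new torsion over H, so unbounded primes stay so. If p is bounded for H, an element
    of p-power order modulo [scaled k] lies in B, hence is killed by q^k c. *)
Lemma unbounded_scaled k p : prime p -> unbounded p (scaled k) <-> unbounded p H.
Proof.
move=> p_pr; split; last first.
  move=> unb j; have [w [w1 w2]] := unb j; exists w; split; first exact: sub_scaled.
  apply: contra w2 => /scaled_isolated; apply; exists p; first exact: prime_gt0.
  by rewrite -mulrnA -expnSr.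
move=> unb; have pN := unbounded_le dccZ divZ ellN p_pr unb.
apply: contrapT => nunb; apply: (unbounded_exponent p_pr (qc_gt0 k) _ unb) => w j.
move=> /scaledP[y /bounded_closureP[n nB yn] wy].
apply/scaledP; exists w; last by rewrite subrr rpred0.
apply/bounded_closureP; exists (p ^ j * n)%N.
  by apply: bounded_numberM => //; apply: bounded_number_pow.
set m := (q ^ k * c)%N in wy.
have -> : w *+ (p ^ j * n) = (w *+ p ^ j - y *+ m) *+ n + y *+ n *+ m by zmod.
by rewrite rpredD // rpredMn //; exact: sub_adjoin.
Qed.

(** Let f be non-torsion modulo H. Membership for one k1 gives n1 f = j1 x modulo H with j1 nonzero;
    for any other k, n f = i q^k x with n prime to q. Comparing, q^k divides j1, which bounds k. *)
Lemma scaled_avoid f : f \notin H -> exists k0, forall k, (k0 <= k)%N -> f \notin scaled k.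
Proof.
move=> fH; have nf k : isolated H f -> f \notin scaled k.
  by move=> fiso; apply: contra fH => /scaled_isolated; apply.
have [fiso|nfiso] := pselect (isolated H f).
  by exists 0%N => k _; apply: nf.
have fxE k : f \in scaled k -> exists2 n, bounded_number n &
    exists i, f *+ n - x *~ (i * (q ^ k)%N%:Z) \in H.
  move=> /scaledP[y /bounded_closureP[n nB /mem_adjoin[i yi]] fy]; exists n => //.
  exists (i * c%:Z); move: fy; rewrite mulnC => fy; set Q := (q ^ k)%N in fy *.
  have -> : f *+ n - x *~ (i * c * Q) = (f - y *+ (c * Q)) *+ n + (y *+ n - x *~ i) *+ (c * Q).
    by zmod.
  by rewrite rpredD // rpredMn.
have [[k1 /fxE[n1 [n1_gt0 _] [i1 f1]]]|nk] := pselect (exists k, f \in scaled k); last first.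
  by exists 0%N => k _; apply/negP => fk; apply: nk; exists k.
set j1 := i1 * _ in f1; have j1_neq0 : j1 != 0.
  by apply/eqP => j10; apply: nfiso; exists n1 => //; move: f1; rewrite j10 mulr0z subr0.
exists `|j1|%N => k jk; apply/negP => /fxE[n [n0 nP] [i fi]].
have : n%:Z * j1 - n1%:Z * (i * (q ^ k)%N%:Z) = 0.
  apply: (eq_of_mulrz nx); set Q := (q ^ k)%N%:Z in fi *.
  have -> : x *~ (n%:Z * j1 - n1%:Z * (i * Q)) =
    (f *+ n - x *~ (i * Q)) *+ n1 - (f *+ n1 - x *~ j1) *+ n by zmod.
  by rewrite rpredB // rpredMn.
move=> /eqP; rewrite subr_eq0 => /eqP e.
have : ((q ^ k)%N%:Z %| n%:Z * j1)%Z by rewrite e mulrA dvdz_mull.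
rewrite dvdzE abszM /= Gauss_dvdr; last first.
  rewrite coprimeXl // prime_coprime //; apply/negP => /(nP q q_pr)[].
  by rewrite leqNgt Nq.
move=> /dvdn_leq; rewrite absz_gt0 => /(_ j1_neq0); apply/negP; rewrite -ltnNge.
by apply: leq_ltn_trans jk (ltn_expl _ _); apply: prime_gt1.
Qed.

End RankSucc.

Lemma corank_succ_rank H (s : seq A) x : ~ isolated H x ->
  exists2 K : subgroups A, forall z, z \in s -> (z \in K) = (z \in H) &
    corank rk N K = (corank rk N H).+1.
Proof.
move=> nx; have [c c0 cP] := bounded_torsion_exponent nx.
have [q Nq q_pr] := prime_above N.
have [k kP] : exists k0, forall k, (k0 <= k)%N -> forall z, z \in s -> z \notin H ->
    z \notin scaled H x c q k.
  elim: s => [|y s [k1 k1P]]; first by exists 0%N.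
  have [k2 k2P] : exists k2, forall k, (k2 <= k)%N -> y \notin H -> y \notin scaled H x c q k.
    have [yH|yH] := boolP (y \in H); first by exists 0%N.
    by have [k2 k2P] := scaled_avoid nx c0 q_pr Nq cP yH; exists k2 => k /k2P.
  exists (maxn k1 k2) => k; rewrite geq_max => /andP[/k1P kz /k2P ky] z.
  by rewrite inE => /predU1P[->|/kz].
exists (scaled H x c q k) => [z zs|].
  apply/idP/idP; last exact: sub_scaled.
  by apply: contraTT; apply: kP.
rewrite /corank (rk_scaled nx c0 q_pr) addSn; congr (_ + _).+1.
apply: eq_bigr => p p_pr; congr (nat_of_bool _).
by apply/asboolP/asboolP => /(unbounded_scaled c0 q_pr cP k p_pr).
Qed.

(** If A/H is torsion, then rk H = r(A); all ell_p being at most 1, the missing corank is due to a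
    prime with ell_p = 1 that is bounded for H. *)
Lemma corank_succ H (s : seq A) : (corank rk N H < height A)%N ->
  exists2 K : subgroups A, forall z, z \in s -> (z \in K) = (z \in H) &
    corank rk N K = (corank rk N H).+1.
Proof.
move=> lt; have [Hiso|/existsNP[x]] := pselect (forall x, isolated H x); last first.
  exact: corank_succ_rank.
have [p [p_pr l0 nunb]] : exists p, [/\ prime p, (0 < ell p A)%N & ~ unbounded p H].
  apply: contrapT => np; move: lt; rewrite ltnNge => /negP; apply.
  rewrite (heightE ellN) leq_add //.
    by rewrite -(rk_full rkP); apply: (rk_le rkP) => x _.
  apply: leq_sum => p p_pr; have [l0|] := posnP (ell p A); first by rewrite l0.
  move=> l0; rewrite asboolT; first by apply: ell_le1 p_pr.
  by apply: contrapT => nunb; apply: np; exists p.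
exact: corank_succ_prufer p_pr l0 nunb.
Qed.

End CorankSucc.

(** * The subgroups of corank 0 *)

Section TopSubgroups.
Variables (A : zmodType) (t : seq A).
Hypotheses (dccZ : dcc (span t))
  (divZ : forall m x, (0 < m)%N -> exists y, x - y *+ m \in span t).
Variable rk : subgroups A -> nat.
Hypothesis rkP : rank_function rk.
Variable N : nat.
Hypothesis ellN : forall p, prime p -> (0 < ell p A)%N -> (p <= N)%N.
Implicit Types (H K : subgroups A) (x y z : A).

Let finA H : finite_socle H := dcc_finite_socle H dccZ (fun=> erefl).

Lemma mem_torsion x : x \in torsion A <-> isolated (span [::]) x.
Proof.
split=> [/asboolP[m m0 xm]|[m m0 /asboolP xm]]; last by apply/asboolP; exists m.
by exists m => //; apply/asboolP.
Qed.

Lemma mem_Div x : x \in Div A <-> forall k : int, k != 0 -> exists y, x = y *~ k.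
Proof. by split=> [/asboolP|]; [|move=> ?; apply/asboolP]. Qed.

(** Take a prime q with no q-torsion modulo Zd: from d = q y follows y = j d, so (1 - j q) d = 0. *)
Lemma Div_torsion : {subset Div A <= torsion A}.
Proof.
move=> d /mem_Div dd; have [_ [M MP]] := finA (span [:: d]).
have [q Mq q_pr] := prime_above M.
have [|y dy] := dd q; first by rewrite eqz_nat -lt0n prime_gt0.
have /mem_adjoin[j /asboolP yj] : y \in span [:: d].
  by apply: (MP q q_pr Mq); rewrite pmulrn -dy; apply: mem_span; rewrite mem_head.
apply/mem_torsion; have : d *~ (1 - j * q) \in span [::].
  apply/asboolP; have -> : d *~ (1 - j * q) = d - y *~ q + (y - d *~ j) *~ q by zmod.
  by rewrite -dy yj subrr mul0rz addr0.
rewrite -rpred_absz => dj; exists (absz (1 - j * q)%R) => //.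
rewrite absz_gt0 subr_eq0; apply: contraTneq (prime_gt1 q_pr) => e.
have : (q%:Z %| 1)%Z by apply/dvdzP; exists j.
by rewrite dvdzE /= dvdn1 => /eqP ->.
Qed.

(** T_A has a finitely generated, hence bounded, subgroup with divisible quotient; multiplying by
    its exponent lands in Div(A). *)
Lemma torsion_exponent : exists2 m, (0 < m)%N &
  forall x, x \in torsion A -> x *+ m \in Div A.
Proof.
have [t' [t'T _ _ t'div]] := divisible_core dccZ (fun=> erefl) (torsion A).
have [m m0 mP] : exists2 m, (0 < m)%N & forall x, x \in span t' -> x *+ m = 0.
  have : {subset t' <= torsion A} by move=> y yt; apply/t'T/mem_span.
  clear t'T t'div; elim: t' => [|z t' IH] tT.
    by exists 1%N => // x /asboolP ->; rewrite mul0rn.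
  have [|m m0 mP] := IH; first by move=> y yt; apply: tT; rewrite inE yt orbT.
  have /asboolP[n n0 zn] := tT z (mem_head _ _).
  exists (m * n)%N; first by rewrite muln_gt0 m0.
  move=> x /mem_adjoin[k /mP xk].
  have -> : x *+ (m * n) = (x - z *~ k) *+ m *+ n + z *+ n *~ (k * m%:Z) by zmod.
  by rewrite xk zn mul0rn mul0rz addr0.
exists m => // x xT; apply/mem_Div => k k0.
have [|y yT /mP] := t'div `|k|%N x _ xT; first by rewrite absz_gt0.
rewrite mulrnBl => /eqP; rewrite subr_eq0 => /eqP ->.
exists (y *+ m *~ sgz k); rewrite -mulrnA.
have kE : `|k|%N%:Z = sgz k * k by rewrite abszEsg.
have -> : y *+ (`|k| * m) = y *~ (`|k|%N%:Z * m%:Z) by zmod.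
by rewrite kE; zmod.
Qed.

(** Rank 0 means torsion. A divisible element outside H yields one of prime order p modulo H with
    all p-power roots, so p is unbounded; above Div(A), the torsion modulo H has an exponent. *)
Lemma corank_eq0 H :
  corank rk N H = 0%N <-> {subset Div A <= H} /\ {subset H <= torsion A}.
Proof.
split.
  move=> /eqP; rewrite addn_eq0 => /andP[/eqP rk0].
  rewrite sum_nat_eq0 => /forallP unb0.
  have nunb p : prime p -> ~ unbounded p H.
    move=> p_pr unb; have pN : (p < N.+1)%N := unbounded_le dccZ divZ ellN p_pr unb.
    by have /implyP/(_ p_pr) := unb0 (Ordinal pN); rewrite asboolT.
  split=> [d dDiv|x xH]; last first.
    apply/mem_torsion; apply: (rk_isolated rkP _ _ xH); last by rewrite rk0.
    by move=> y /asboolP ->; exists 1%N; rewrite ?mul0rn ?rpred0.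
  apply: contraT => dH; have /asboolP[n n0 dn] := Div_torsion dDiv.
  have dnH : d *+ n \in H by rewrite dn rpred0.
  have [i [p [p_pr _ yH yp]]] := torsion_prime n0 dnH dH.
  case: (nunb p p_pr) => k.
  have /mem_Div/(_ (p ^ k)%N%:Z) : d *+ i \in Div A by rewrite rpredMn.
  case; first by rewrite eqz_nat -lt0n expn_gt0 prime_gt0.
  move=> z zE; exists z; rewrite expnSr mulrnA !pmulrn -zE -pmulrn.
  by split.
move=> [DH HT]; apply/eqP; rewrite addn_eq0 sum_nat_eq0; apply/andP; split.
  rewrite -leqn0 -(rk_triv rkP); apply: (rk_le rkP) => x /HT.
  by move/mem_torsion.
apply/forallP => p; apply/implyP => p_pr; rewrite asboolF //.
have [m m0 mP] := torsion_exponent.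
apply: (unbounded_exponent p_pr m0) => w j /HT /mem_torsion[n n0 wn].
apply/DH/mP/mem_torsion; exists (p ^ j * n)%N; last by rewrite mulrnA.
by rewrite muln_gt0 expn_gt0 prime_gt0.
Qed.

(** Correspondence with the subgroups of T_A/Div(A). That group must be shown finite, from its
    exponent and the finite socles, since [fset_set] is empty on infinite sets. *)
Lemma subgroups_between : exists s : seq (subgroups A),
  [/\ uniq s, size s = card_subgroups_TDiv A, (0 < size s)%N &
  forall H, H \in s <-> {subset Div A <= H} /\ {subset H <= torsion A}].
Proof.
set Q := subquotient (torsion A) (Div A).
have [pi [pi_surj pi0]] := quot_proj (subgroup_in (Div A) (torsion A)).
have pi0P u : pi u = 0 <-> val u \in Div A.
  split=> [u0|uD].
    have : u \in subgroup_in (Div A) (torsion A) by rewrite -pi0 u0.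
    by move/asboolP.
  by apply/eqP; rewrite pi0; apply/asboolP.
have lift_closed (G : subgroups Q) : zmod_closed (fun x =>
    `[< exists2 u : subgroup_type (torsion A), val u = x & pi u \in G >]).
  split=> [|_ _ /asboolP[u <- uG] /asboolP[v <- vG]]; apply/asboolP.
    by exists 0; rewrite ?raddf0 ?rpred0.
  by exists (u - v); rewrite ?raddfB ?rpredB.
pose lift G := Subgroup (lift_closed G).
have liftP G u : (val u \in lift G) = (pi u \in G).
  apply/asboolP/idP => [[v /val_inj -> //]|uG]; by exists u.
have lift_inj : injective lift.
  move=> G G' GG'; apply: subgroup_ext => q; have [u <-] := pi_surj q.
  by rewrite -!liftP GG'.
have liftE H : (exists G, lift G = H) <-> {subset Div A <= H} /\ {subset H <= torsion A}.
  split=> [[G <-]|[DH HT]].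
    split=> [d dD|x /asboolP[u <- _]]; last exact: valP.
    have dT := Div_torsion dD.
    pose u : subgroup_type (torsion A) := exist (fun x => x \in subgroup_mem (torsion A)) d dT.
    by rewrite -[d]/(val u) liftP (pi0P u).2 // rpred0.
  have im_closed : zmod_closed (fun q => `[< exists2 u, val u \in H & pi u = q >]).
    split=> [|_ _ /asboolP[u uH <-] /asboolP[v vH <-]]; apply/asboolP.
      by exists 0; rewrite ?raddf0 ?rpred0.
    by exists (u - v); rewrite !raddfB ?rpredB.
  exists (Subgroup im_closed); apply: subgroup_ext => x; apply/asboolP/idP.
    move=> [u <- /asboolP[v vH vu]].
    have -> : val u = val v + val (u - v) by rewrite raddfB addrC subrK.
    by rewrite rpredD // DH //; apply/pi0P; rewrite raddfB vu subrr.
  move=> xH; pose u : subgroup_type (torsion A) :=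
    exist (fun x => x \in subgroup_mem (torsion A)) x (HT x xH).
  by exists u => //; apply/asboolP; exists u.
have [R RP] : exists R : seq Q, forall q, q \in R.
  have [m m0 mP] := torsion_exponent.
  have [s sP] := fin_cosets_nroot finA (Div A) m0.
  exists [seq pi u | u <- pmap insub s] => q; have [u <-] := pi_surj q.
  have [y ys uy] := sP (val u) (mP _ (valP u)).
  have yT : y \in torsion A.
    have -> : y = val u - (val u - y) by zmod.
    by rewrite rpredB ?(valP u) // Div_torsion.
  pose v : subgroup_type (torsion A) := exist (fun x => x \in subgroup_mem (torsion A)) y yT.
  apply/mapP; exists v; first by rewrite mem_pmap_sub.
  by apply/eqP; rewrite -subr_eq0 -raddfB; apply/eqP/pi0P; rewrite raddfB.
have fin : finite_set [set: subgroups Q].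
  pose F (G : subgroups Q) := [ffun i : 'I_(size R) => R`_i \in G].
  have -> : [set: subgroups Q] = F @^-1` setT by apply/seteqP.
  apply: finite_preimage; last exact: finite_finset.
  move=> G G' _ _ /ffunP FGG'; apply: subgroup_ext => q.
  have iR : (index q R < size R)%N by rewrite index_mem RP.
  by have := FGG' (Ordinal iR); rewrite !ffunE /= nth_index.
have memS G : G \in finmap.enum_fset (fset_set [set: subgroups Q]).
  by rewrite [_ \in _](in_fset_set fin G) in_setT.
exists (map lift (finmap.enum_fset (fset_set [set: subgroups Q]))); split.
- by rewrite map_inj_uniq // finmap.fset_uniq.
- by rewrite size_map.
- rewrite size_map; have := memS (full Q).
  by case: (finmap.enum_fset _).
- move=> H; rewrite -liftE; split=> [/mapP[G _ ->]|[G <-]]; first by exists G.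
  by apply: map_f; exact: memS.
Qed.

End TopSubgroups.

(** * The topology of the space of subgroups *)

Section SubgroupSpace.
Variable A : zmodType.
Implicit Types (H K : subgroups A) (s : seq A).

Lemma membership_continuous (x : A) :
  continuous (fun H : subgroups A => (set_val H : prod_topology (fun _ : A => bool)) x).
Proof.
move=> H; apply: (@continuous_comp (subgroups A) (prod_topology (fun _ : A => bool)) bool
  set_val (fun P => P x)); first exact: initial_continuous.
exact: (@proj_continuous A (fun=> bool) x).
Qed.

Lemma nbhs_agree H s : nbhs H [set K : subgroups A | forall x, x \in s -> (x \in K) = (x \in H)].
Proof.
elim: s => [|y s IH]; first by apply: filterS filterT => K _ x.
have ny : nbhs H [set K : subgroups A | (y \in K) = (y \in H)].
  exact: (membership_continuous (discrete_set1 _)).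
by apply: filterS2 ny IH => K yK sK x; rewrite inE => /predU1P[->|/sK].
Qed.

Lemma agree_of_nbhs H (W : set (subgroups A)) : nbhs H W ->
  exists s, forall K, (forall x, x \in s -> (x \in K) = (x \in H)) -> W K.
Proof.
move=> [_ [[B oB <-] BH] BW].
have [s [O [OH OB]]] := nbhs_prod_topology (open_nbhs_nbhs (conj oB BH)).
exists s => K KH; apply: BW; apply: OB => x xs.
have -> : set_val K x = set_val H x by apply: KH.
exact: nbhs_singleton.
Qed.

Lemma subgroups_closed : closed (@subgroup_set A).
Proof.
move=> P clP; have agree s : exists2 Q : prod_topology (fun _ : A => bool),
    subgroup_set Q & forall x, x \in s -> Q x = P x.
  suff nP : nbhs P [set Q : prod_topology (fun _ : A => bool) | forall x, x \in s -> Q x = P x].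
    by have [Q [SQ QP]] := clP _ nP; exists Q.
  elim: s => [|y s IH]; first by apply: filterS filterT => K _ x.
  have ny : nbhs P [set Q : prod_topology (fun _ : A => bool) | Q y = P y].
    exact: (@proj_continuous A (fun=> bool) y P _ (discrete_set1 _)).
  by apply: filterS2 ny IH => K yK sK x; rewrite inE => /predU1P[->|/sK].
split=> [|x y xP yP].
  have [Q [Q0 _] QP] := agree [:: 0]; rewrite -[_ \in _]/(P 0 : bool) -QP ?mem_head //.
have [Q [_ QB] QP] := agree [:: x; y; x - y].
rewrite -[_ \in _]/(P (x - y) : bool) -QP ?inE ?eqxx ?orbT //; apply: QB.
  by rewrite -[_ \in _]/(Q x : bool) QP ?mem_head.
by rewrite -[_ \in _]/(Q y : bool) QP ?inE ?eqxx ?orbT.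
Qed.

Lemma subgroups_compact : compact [set: subgroups A].
Proof.
have cS : compact (@subgroup_set A).
  have c2 : compact [set: prod_topology (fun _ : A => bool)].
    have := @tychonoff A (fun=> bool) (fun=> setT) (fun=> bool_compact).
    by congr compact; apply/seteqP.
  exact: subclosed_compact subgroups_closed c2 _.
move=> F FF _; have [|P [SP clP]] := cS (set_val @ F) _.
  apply: (@filterS _ F _ setT) => [H _|]; last exact: filterT.
  exact: subgroup_mem_closed.
exists (SigSub (mem_set SP)); split => // U W FU [_ [[B oB <-] BP] BW].
have [|_ [[H UH <-] BH]] := clP (set_val @` U) B _ (open_nbhs_nbhs (conj oB BP)).
  by apply: (@filterS _ F _ U) FU => H UH; exists H.
by exists H; split => //; apply: BW.
Qed.

Lemma subgroups_zero_dimensional : zero_dimensional (subgroups A).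
Proof.
move=> H K HK.
have [x xHK] : exists x, (x \in subgroup_mem H) <> (x \in subgroup_mem K).
  by apply/existsNP => e; case/eqP: HK; apply: subgroup_ext.
pose b := x \in subgroup_mem H.
exists [set L : subgroups A | (x \in L) = b]; split => //; last by move/esym.
have -> : [set L : subgroups A | (x \in L) = b] =
  (fun L : subgroups A => (set_val L : prod_topology (fun _ : A => bool)) x) @^-1` [set b].
  by [].
apply: preimage_clopen; last exact: membership_continuous.
by split; [exact: discrete_open|exact: discrete_closed].
Qed.

Lemma subgroups_hausdorff : hausdorff_space (subgroups A).
Proof.
move=> H K clHK; apply: subgroup_ext => x.
have [L [LH LK]] := clHK _ _ (nbhs_agree H [:: x]) (nbhs_agree K [:: x]).
by rewrite -LH ?mem_head // LK ?mem_head.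
Qed.

End SubgroupSpace.

Theorem theoremC (A : zmodType) (hA : minimax A) (hncrit : ~ critical A) :
  countable [set: subgroups A] /\
  homeomorphic (subgroups A) (D_pow (height A) * discrete_ord (card_subgroups_TDiv A))%type.
Proof.
have [t [dccZ divZ]] := minimax_divisible_quotient hA.
have [rk rkP] : exists rk : subgroups A -> nat, rank_function rk.
  by apply: (@rank_function_minimax _ t) => x; have [n n0 xn] := dcc_torsion x dccZ; exists n.
have [N ellN] := ell_large dccZ divZ.
(* The truncated subtraction is harmless, since the corank is at most the height. *)
pose rho H := (height A - corank rk N H)%N.
have corankh := corank_le dccZ divZ rkP ellN.
have /choice[s sP] := corank_isolated dccZ divZ hncrit rkP ellN.
have cS : countable [set: subgroups A].
  have /countable_injP[e einj] := minimax_countable dccZ (fun=> erefl).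
  have e_inj : injective e by move=> x y; apply: einj; rewrite in_setT.
  apply/countable_injP.
  (* H is determined by its test list, its trace on that list and its corank: if K shares all three,
     the alternative of a larger corank is excluded. *)
  exists (fun H => pickle (map e (s H), [seq x \in H | x <- s H], corank rk N H)).
  move=> H K _ _ /(pcan_inj pickleK)[/(inj_map e_inj) sHK mHK cHK].
  rewrite sHK in mHK; have [|//|] := sP K H; last by rewrite cHK ltnn.
  by move=> x xs; move/eq_in_map: mHK => /(_ x xs).
have rS : ranked rho.
  have cpt := @subgroups_compact A; have hdf := @subgroups_hausdorff A.
  split => //.
  - exact: compact_zero_dimensional_clopen cpt hdf (@subgroups_zero_dimensional A).
  - move=> H; apply: filterS (nbhs_agree H (s H)) => K /sP[->|lt]; [by left|right].
    by have := corankh K; rewrite /rho; lia.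
  - move=> H W /agree_of_nbhs[s' s'W] rho0.
    have [|K KH Kc] := corank_succ dccZ divZ hncrit rkP ellN (H := H) s'.
      by move: rho0; rewrite /rho; lia.
    by exists K; [exact: s'W|rewrite /rho Kc; lia].
have [s0 [s0_uniq s0_size s0_gt0 s0P]] := subgroups_between dccZ.
split=> //; apply: (ranked_homeomorphic rS (ranked_nb_infinite _ _) s0_gt0 _ _
  (enumerates_top_nb_infinite _ _)).
  by rewrite size_map size_enum_ord.
split=> // [H _|H]; first exact: leq_subr.
rewrite s0P -(corank_eq0 dccZ divZ rkP ellN) /rho; have := corankh H.
by split=> [->|[_]]; [rewrite subn0|lia].
Qed.
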